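(* Let $d\ge2$ and $N,M\ge1$ be integers. Let $|\psi\rangle=U|0\rangle$ and $|\phi\rangle=V|0\rangle$ with $U,V\in SU(d)$ independent and Haar distributed, let $c=|\langle\psi|\phi\rangle|^2$ and $|\Psi\rangle=|\psi\rangle^{\otimes N}\otimes|\phi\rangle^{\otimes M}$. For a POVM $\{E_k\}_k$ on $(\mathbb{C}^d)^{\otimes(N+M)}$ and a real-valued estimator $k\mapsto c(k)$ define the global mean square error $$v=\sum_k\int dU\,dV\,(c(k)-c)^2\,\langle\Psi|E_k|\Psi\rangle .$$ Then the minimum of $v$ over all POVMs and all estimators is attained by a projective measurement (with a suitable estimator), and it equals $$v_{\rm op}=\frac{(d-1)(d+M+N)}{d(d+1)(d+M)(d+N)}.$$
   Context: $|0\rangle\in\mathbb{C}^d$ is a fixed unit vector; $dU,dV$ are the normalized Haar measures on $SU(d)$. A POVM is a (finite) family of positive semidefinite operators summing to the identity. *)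

(* Defs.v *)
From HB Require Import structures.
From mathcomp Require Import all_boot all_order all_algebra.
From mathcomp Require Import complex mxtens.
From mathcomp Require Import all_classical all_reals all_analysis.

Set Implicit Arguments.
Unset Strict Implicit.
Unset Printing Implicit Defensive.

Import Order.TTheory GRing.Theory Num.Theory.
Import numFieldNormedType.Exports.

Local Open Scope classical_set_scope.
Local Open Scope ring_scope.
Local Open Scope complex_scope.
Local Open Scope sesquilinear_scope.

(* R[i] with the topology of its modulus *)
HB.instance Definition _ (R : rcfType) :=
  PseudoPointedMetric.copy R[i] (R[i] : numFieldType)^o.

Section special_unitary_group.
Variables (R : realType) (d : nat).

Record SU := MkSU {
  su_mx :> 'M[R[i]]_d ;
  su_mxP : (su_mx \is unitarymx) && (\det su_mx == 1) }.

HB.instance Definition _ := [isSub for su_mx].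
HB.instance Definition _ := [Choice of SU by <:].

Lemma su_unitary (g : SU) : su_mx g \is unitarymx.
Proof. by case/andP: (su_mxP g). Qed.

Lemma su_det (g : SU) : \det (su_mx g) = 1.
Proof. by case/andP: (su_mxP g) => _ /eqP. Qed.

Lemma su_one_proof :
  ((1%:M : 'M[R[i]]_d) \is unitarymx) && (\det (1%:M : 'M[R[i]]_d) == 1).
Proof.
by rewrite det1 eqxx andbT; apply/unitarymxP; rewrite trmx1 map_mx1 mulmx1.
Qed.

Lemma su_mul_proof (g h : SU) :
  (su_mx g *m su_mx h \is unitarymx) && (\det (su_mx g *m su_mx h) == 1).
Proof. by rewrite det_mulmx !su_det mulr1 eqxx andbT mul_unitarymx ?su_unitary. Qed.

Lemma su_inv_proof (g : SU) :
  ((su_mx g)^t* \is unitarymx) && (\det ((su_mx g)^t*) == 1).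
Proof. by rewrite trmxC_unitary su_unitary det_map_mx det_tr su_det rmorph1 eqxx. Qed.

Definition su_one : SU := MkSU su_one_proof.
Definition su_mul (g h : SU) : SU := MkSU (su_mul_proof g h).
Definition su_inv (g : SU) : SU := MkSU (su_inv_proof g).

Fact su_mulA : associative su_mul.
Proof. by move=> x y z; apply/val_inj; rewrite /= mulmxA. Qed.

Fact su_mul1 : left_id su_one su_mul.
Proof. by move=> x; apply/val_inj; rewrite /= mul1mx. Qed.

Fact su_1mul : right_id su_one su_mul.
Proof. by move=> x; apply/val_inj; rewrite /= mulmx1. Qed.

Fact su_mulV : right_inverse su_one su_inv su_mul.
Proof. by move=> x; apply/val_inj; rewrite /= (unitarymxP (su_unitary x)). Qed.

Fact su_mulVl : left_inverse su_one su_inv su_mul.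
Proof.
by move=> x; apply/val_inj; rewrite /= (mulmx1C (unitarymxP (su_unitary x))).
Qed.

HB.instance Definition _ :=
  isGroup.Build SU su_mulA su_mul1 su_1mul su_mulVl su_mulV.

HB.instance Definition _ := isPointed.Build SU su_one.

HB.instance Definition _ := Topological.copy SU (initial_topology su_mx).

HB.instance Definition _ :=
  Measurable.copy SU (g_sigma_algebraType (@open SU)).

(* Normalization is carried by the type [probability]. On a compact group a
   left-invariant probability is also right-invariant, and is unique. *)
Definition haar_probability (mu : probability SU R) : Prop :=
  forall (g : SU) (A : set SU), measurable A ->
    mu ((fun u : SU => (g * u)%g) @^-1` A) = mu A.

End special_unitary_group.

Section measurements.
Variables (R : realType) (D : nat).
Implicit Types (A : 'M[R[i]]_D) (x : 'cV[R[i]]_D).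

(* <x|A|x>; [x^t*] is the conjugate transpose *)
Definition expval A x : R[i] := (x^t* *m A *m x) 0 0.

Definition psdmx A : Prop :=
  A \is hermsymmx /\ forall x, 0 <= expval A x.

Definition povm (m : nat) (E : 'I_m -> 'M[R[i]]_D) : Prop :=
  (forall k, psdmx (E k)) /\ \sum_(k < m) E k = 1%:M.

Definition projective_povm (m : nat) (E : 'I_m -> 'M[R[i]]_D) : Prop :=
  povm E /\ forall k l, E k *m E l = if k == l then E k else 0.

End measurements.

Section overlap_estimation.
Variables (R : realType) (d N M : nat).
Implicit Types (psi phi : 'cV[R[i]]_d).

Fact exp1nMexp1n : (1 ^ N * 1 ^ M = 1)%N.
Proof. by rewrite !exp1n. Qed.

(* psi^(tensor N) tensor phi^(tensor M), as a column vector; the casts only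
   identify the dimensions d^N * d^M with d^(N+M), and 1^N * 1^M with 1. *)
Definition joint_state psi phi : 'cV[R[i]]_(d ^ (N + M)) :=
  castmx (esym (expnD d N M), exp1nMexp1n) (ntensmx psi N *t ntensmx phi M).

(* |<psi|phi>|^2 *)
Definition overlap psi phi : R :=
  complex.Re (`|(psi^t* *m phi) 0 0| ^+ 2).

(* The real part is taken only to change type: these numbers are real. *)
Definition outcome_prob (A : 'M[R[i]]_(d ^ (N + M))) psi phi : R :=
  complex.Re (expval A (joint_state psi phi)).

Definition global_mse (haar : probability (SU R d) R) (ket0 : 'cV[R[i]]_d)
    (m : nat) (E : 'I_m -> 'M[R[i]]_(d ^ (N + M))) (c : 'I_m -> R) : \bar R :=
  (\sum_(k < m) \int[haar \x haar]_w
     ((c k - overlap (su_mx w.1 *m ket0) (su_mx w.2 *m ket0)) ^+ 2 *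
      outcome_prob (E k) (su_mx w.1 *m ket0) (su_mx w.2 *m ket0))%:E)%E.

End overlap_estimation.

(* Main.v *)
Require Import Defs.
From HB Require Import structures.
From mathcomp Require Import all_boot all_order all_algebra.
From mathcomp Require Import complex mxtens.
From mathcomp Require Import all_classical all_reals all_analysis.
From mathcomp Require Import measurable_realfun.
From mathcomp Require Import ring lra.

(* Write <X> for the expectation value of X in the state psi^N (x) phi^M and o
   for the overlap. If L is a hermitian operator with E[o <X>] = E[<X L>] for
   all X (the operator analogue of a posterior mean), then for every POVM
     sum_k E[(c_k - o)^2 <E_k>] =
       sum_k E[<(c_k - L) E_k (c_k - L)>] + E[o^2] - E[o <L>].
   The first sum is nonnegative, and it vanishes for the spectral projections
   and eigenvalues of L.

   Such an L is (d + N + M + sum_(i, j) SWAP_(i, j)) / ((d + N)(d + M)). Since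
   o = sum_(a, b) <E_ab>_psi <E_ba>_phi is a sum of products, this reduces to
   the one-register recursion
     (d + n) E[<X> <Y>_n] = E[<Y (tr X + Gamma_n X)>_n],
   where <.>_n refers to psi^n and Gamma_n X = sum_i X_i. The recursion comes
   from E[<[Z, Gamma_(n+1) X]>_(n+1)] = 0 for Z = E_cb (x) Y and X = E_ac,
   summed over c. That identity is the infinitesimal form of the Haar
   invariance; it is obtained without differentiation from the unitaries
   1 + s v v^*, because a polynomial in s that vanishes on infinitely many
   points of a circle has zero coefficients. *)

Set Implicit Arguments.
Unset Strict Implicit.
Unset Printing Implicit Defensive.

Import Order.TTheory GRing.Theory Num.Theory.
Import numFieldNormedType.Exports.
Local Open Scope ring_scope.
Local Open Scope complex_scope.
Local Open Scope sesquilinear_scope.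

(** * Tensor powers *)

Section tensor_algebra.
Variable K : comPzRingType.

Lemma tensmxDl m n p q (A A' : 'M[K]_(m, n)) (B : 'M[K]_(p, q)) :
  (A + A') *t B = A *t B + A' *t B.
Proof. by apply/matrixP=> i j; rewrite !mxE mulrDl. Qed.

Lemma tensmxDr m n p q (A : 'M[K]_(m, n)) (B B' : 'M[K]_(p, q)) :
  A *t (B + B') = A *t B + A *t B'.
Proof. by apply/matrixP=> i j; rewrite !mxE mulrDr. Qed.

Lemma tensmxZl m n p q s (A : 'M[K]_(m, n)) (B : 'M[K]_(p, q)) :
  (s *: A) *t B = s *: (A *t B).
Proof. by apply/matrixP=> i j; rewrite !mxE mulrA. Qed.

Lemma tensmxZr m n p q s (A : 'M[K]_(m, n)) (B : 'M[K]_(p, q)) :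
  A *t (s *: B) = s *: (A *t B).
Proof. by apply/matrixP=> i j; rewrite !mxE mulrCA. Qed.

Lemma tensmx_sumr m n p q (I : finType) (A : 'M[K]_(m, n))
    (B : I -> 'M[K]_(p, q)) :
  A *t (\sum_i B i) = \sum_i A *t B i.
Proof.
elim/big_rec2: _ => [|i x y _ <-]; first by rewrite tensmx0.
by rewrite tensmxDr.
Qed.

Lemma tens1mx1 m n : (1%:M : 'M[K]_m) *t (1%:M : 'M[K]_n) = 1%:M.
Proof.
apply/matrixP=> i j.
case: (mxtens_indexP i) => i0 i1; case: (mxtens_indexP j) => j0 j1.
rewrite tensmxE !mxE -natrM mulnb -xpair_eqE.
by rewrite (can_eq (@mxtens_indexK m n)).
Qed.

Lemma delta_mx_tens m n p q (i : 'I_m) (j : 'I_n) (k : 'I_p) (l : 'I_q) :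
  delta_mx (mxtens_index (i, k)) (mxtens_index (j, l)) =
  delta_mx i j *t delta_mx k l :> 'M[K]_(_, _).
Proof.
apply/matrixP=> a b.
case: (mxtens_indexP a) => a0 a1; case: (mxtens_indexP b) => b0 b1.
rewrite tensmxE !mxE !(can_eq (@mxtens_indexK _ _)) !xpair_eqE.
by rewrite -natrM mulnb andbACA.
Qed.

End tensor_algebra.

(** * Expectation values, adjoints and product vectors *)

Section expval_theory.
Variable R : realType.
Local Notation C := R[i].

Lemma trmxC_mul m n p (A : 'M[C]_(m, n)) (B : 'M[C]_(n, p)) :
  (A *m B)^t* = B^t* *m A^t*.
Proof. by rewrite trmx_mul map_mxM. Qed.

Lemma trmxC_tens m n p q (A : 'M[C]_(m, n)) (B : 'M[C]_(p, q)) :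
  (A *t B)^t* = A^t* *t B^t*.
Proof. by rewrite trmx_tens map_mxT. Qed.

Lemma trmxCD m n (A B : 'M[C]_(m, n)) : (A + B)^t* = A^t* + B^t*.
Proof. by rewrite linearD map_mxD. Qed.

Lemma trmxCZ m n (s : C) (A : 'M[C]_(m, n)) : (s *: A)^t* = (s^*)%R *: A^t*.
Proof. by rewrite linearZ map_mxZ. Qed.

Lemma trmxC1 n : (1%:M : 'M[C]_n)^t* = 1%:M.
Proof. by rewrite trmx1 map_mx1. Qed.

Lemma trmxC_delta m n (i : 'I_m) (j : 'I_n) :
  (delta_mx i j : 'M[C]_(m, n))^t* = delta_mx j i.
Proof. by rewrite trmx_delta map_delta_mx. Qed.

Lemma expvalD D (A B : 'M[C]_D) x : expval (A + B) x = expval A x + expval B x.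
Proof. by rewrite /expval mulmxDr mulmxDl mxE. Qed.

Lemma expvalZ D s (A : 'M[C]_D) x : expval (s *: A) x = s * expval A x.
Proof. by rewrite /expval -scalemxAr -scalemxAl mxE. Qed.

Lemma expvalN D (A : 'M[C]_D) x : expval (- A) x = - expval A x.
Proof. by rewrite -scaleN1r expvalZ mulN1r. Qed.

Lemma expvalB D (A B : 'M[C]_D) x : expval (A - B) x = expval A x - expval B x.
Proof. by rewrite expvalD expvalN. Qed.

Lemma expval0 D (x : 'cV[C]_D) : expval 0 x = 0.
Proof. by rewrite /expval mulmx0 mul0mx mxE. Qed.

Lemma expval_sum D (I : finType) (P : pred I) (A : I -> 'M[C]_D) x :
  expval (\sum_(i | P i) A i) x = \sum_(i | P i) expval (A i) x.
Proof.
elim/big_rec2: _ => [|i y z _ <-]; first by rewrite expval0.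
by rewrite expvalD.
Qed.

Lemma expval1 D (x : 'cV[C]_D) : x^t* *m x = 1%:M -> expval 1%:M x = 1.
Proof. by move=> x1; rewrite /expval mulmx1 x1 mxE. Qed.

Lemma expval_conj D (A : 'M[C]_D) x : expval (A^t*) x = (expval A x)^*%R.
Proof.
rewrite /expval -[in RHS](trmxK (_ *m _ *m x)) [in RHS]mxE.
transitivity (((x^t* *m A *m x)^t*) 0 0); last by rewrite !mxE.
by rewrite !trmxC_mul trmxCK mulmxA.
Qed.

Lemma expval_delta D (i j : 'I_D) (x : 'cV[C]_D) :
  expval (delta_mx i j) x = (x i 0)^*%R * x j 0.
Proof.
rewrite /expval -(mul_delta_mx (ord0 : 'I_1)) mulmxA -mulmxA mxE big_ord1.
by rewrite -colE -rowE !mxE.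
Qed.

Lemma expval_mulmx D m (A : 'M[C]_m) (B : 'M[C]_(m, D)) (x : 'cV[C]_D) :
  expval A (B *m x) = expval (B^t* *m A *m B) x.
Proof. by rewrite /expval trmxC_mul !mulmxA. Qed.

(* [x *t y] as a column vector: its width [1 * 1] is only convertible to 1. *)
Definition tensv m n (x : 'cV[C]_m) (y : 'cV[C]_n) : 'cV[C]_(m * n) := x *t y.

Lemma tensvE m n (x : 'cV[C]_m) (y : 'cV[C]_n) i :
  tensv x y i 0 = x (mxtens_unindex i).1 0 * y (mxtens_unindex i).2 0.
Proof.
by rewrite mxE ![(mxtens_unindex (0 : 'I_(1 * 1))).1]ord1
  ![(mxtens_unindex (0 : 'I_(1 * 1))).2]ord1.
Qed.

Lemma mul_tensv m n p q (A : 'M[C]_(m, n)) (B : 'M[C]_(p, q)) x y :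
  (A *t B) *m tensv x y = tensv (A *m x) (B *m y).
Proof. exact: (@tensmx_mul _ m n p q 1 1). Qed.

Lemma tensvDl m n (x x' : 'cV[C]_m) (y : 'cV[C]_n) :
  tensv (x + x') y = tensv x y + tensv x' y.
Proof. exact: (@tensmxDl _ m 1 n 1). Qed.

Lemma tensvDr m n (x : 'cV[C]_m) (y y' : 'cV[C]_n) :
  tensv x (y + y') = tensv x y + tensv x y'.
Proof. exact: (@tensmxDr _ m 1 n 1). Qed.

Lemma tensvZl m n s (x : 'cV[C]_m) (y : 'cV[C]_n) :
  tensv (s *: x) y = s *: tensv x y.
Proof. exact: (@tensmxZl _ m 1 n 1). Qed.

Lemma tensvZr m n s (x : 'cV[C]_m) (y : 'cV[C]_n) :
  tensv x (s *: y) = s *: tensv x y.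
Proof. exact: (@tensmxZr _ m 1 n 1). Qed.

Lemma tensv0l m n (y : 'cV[C]_n) : tensv (0 : 'cV[C]_m) y = 0.
Proof. exact: (@tens0mx _ m 1 n 1). Qed.

Lemma tensv0r m n (x : 'cV[C]_m) : tensv x (0 : 'cV[C]_n) = 0.
Proof. exact: (@tensmx0 _ m 1 n 1). Qed.

Lemma dot_tensv m n (x x' : 'cV[C]_m) (y y' : 'cV[C]_n) :
  (tensv x y)^t* *m tensv x' y' = (x^t* *m x') *t (y^t* *m y').
Proof.
have -> : (tensv x y)^t* = x^t* *t y^t* by exact: (@trmxC_tens m 1 n 1).
exact: (@tensmx_mul _ 1 m 1 n 1 1).
Qed.

Lemma tensv_unit m n (x : 'cV[C]_m) (y : 'cV[C]_n) :
  x^t* *m x = 1%:M -> y^t* *m y = 1%:M ->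
  (tensv x y)^t* *m tensv x y = 1%:M.
Proof. by move=> x1 y1; rewrite dot_tensv x1 y1 tens1mx1. Qed.

Lemma expval_tens m n (A : 'M[C]_m) (B : 'M[C]_n) x y :
  expval (A *t B) (tensv x y) = expval A x * expval B y.
Proof.
rewrite /expval -mulmxA mul_tensv dot_tensv [in LHS]mxE !mulmxA.
by rewrite ![(mxtens_unindex _).1]ord1 ![(mxtens_unindex _).2]ord1.
Qed.

End expval_theory.

(** * Tensor powers of vectors and operators, and their derivations *)

Section tensor_powers.
Variables (R : realType) (d : nat).
Local Notation C := R[i].
Implicit Types (X g : 'M[C]_d) (psi chi : 'cV[C]_d).

(* Unlike [d ^ n], this satisfies the recursion by conversion. *)
Fixpoint pw n : nat := if n is n'.+1 then (d * pw n')%N else 1%N.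

Fixpoint tv psi n : 'cV[C]_(pw n) :=
  if n is n'.+1 then tensv psi (tv psi n') else 1%:M.

Fixpoint tp g n : 'M[C]_(pw n) :=
  if n is n'.+1 then g *t tp g n' else 1%:M.

(* The derivation sum_i X_i: X acting on one tensor factor at a time. *)
Fixpoint deriv X n : 'M[C]_(pw n) :=
  if n is n'.+1 then X *t 1%:M + 1%:M *t deriv X n' else 0.

(* sum_i psi (x) .. (x) chi (x) .. (x) psi, with chi in position i *)
Fixpoint dtv psi chi n : 'cV[C]_(pw n) :=
  if n is n'.+1 then
    tensv chi (tv psi n') + tensv psi (dtv psi chi n')
  else 0.

(* The coefficient of s^k in the n-th tensor power of 1 + s X. *)
Fixpoint tpcoef X n k : 'M[C]_(pw n) :=
  match n, k with
  | 0, 0 => 1%:M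
  | 0, _.+1 => 0
  | n'.+1, 0 => 1%:M *t tpcoef X n' 0
  | n'.+1, k'.+1 => 1%:M *t tpcoef X n' k'.+1 + X *t tpcoef X n' k'
  end.

Lemma tpcoef_gt X n k : (n < k)%N -> tpcoef X n k = 0.
Proof.
elim: n k => [|n IH] [|k] //= lt_nk.
by rewrite (IH _ (ltnW lt_nk)) (IH k lt_nk) !tensmx0 addr0.
Qed.

Lemma tpcoef0 X n : tpcoef X n 0 = 1%:M.
Proof. by elim: n => //= n ->; rewrite tens1mx1. Qed.

Lemma tpcoef1 X n : tpcoef X n 1 = deriv X n.
Proof. by elim: n => //= n ->; rewrite tpcoef0 addrC. Qed.

(** The first tensor factor contributes either [1], keeping the degree in s, or [s X], raising it by
    one; this is the recursion behind [tpcoef]. *)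
Lemma tp_1D X s n :
  tp (1%:M + s *: X) n = \sum_(k < n.+1) s ^+ k *: tpcoef X n k.
Proof.
elim: n => [|n IH]; first by rewrite big_ord1 expr0 scale1r.
rewrite [LHS]/= IH tensmxDl !tensmx_sumr [RHS]big_ord_recl expr0 scale1r.
rewrite [Y in _ = _ + Y](eq_bigr (fun k : 'I_n.+1 =>
    1%:M *t (s ^+ k.+1 *: tpcoef X n k.+1) +
    (s *: X) *t (s ^+ k *: tpcoef X n k))); last first.
  by move=> k _; rewrite /= /bump leq0n add1n scalerDr !tensmxZl !tensmxZr
    scalerA exprS.
rewrite big_split /= addrA; congr (_ + _).
(* The branch with factor [1] has no term of degree n + 1, as the shorter power has degree n. *)
rewrite [Y in _ = _ + Y]big_ord_recr /= [tpcoef X n n.+1]tpcoef_gt //.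
rewrite scaler0 tensmx0 addr0.
by rewrite big_ord_recl expr0 scale1r; congr (_ + _).
Qed.

Lemma tp_mul_tv g psi n : tp g n *m tv psi n = tv (g *m psi) n.
Proof.
elim: n => [|n IH] /=; first by rewrite mulmx1.
by rewrite mul_tensv IH.
Qed.

Lemma tpM g h n : tp g n *m tp h n = tp (g *m h) n.
Proof.
elim: n => [|n IH] /=; first by rewrite mulmx1.
by rewrite tensmx_mul IH.
Qed.

Lemma tp1 n : tp 1%:M n = 1%:M.
Proof. by elim: n => //= n ->; rewrite tens1mx1. Qed.

Lemma trmxC_tp g n : (tp g n)^t* = tp (g^t*) n.
Proof.
by elim: n => [|n IH] /=; rewrite ?trmxC1// trmxC_tens IH.
Qed.

Lemma tpZ s g n : tp (s *: g) n = s ^+ n *: tp g n.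
Proof.
elim: n => [|n IH] /=; first by rewrite expr0 scale1r.
by rewrite IH tensmxZl tensmxZr scalerA exprS.
Qed.

Lemma tv_unit psi n : psi^t* *m psi = 1%:M -> (tv psi n)^t* *m tv psi n = 1%:M.
Proof.
move=> psi1; elim: n => [|n IH] /=; first by rewrite trmxC1 mulmx1.
exact: tensv_unit.
Qed.

Lemma trmxC_deriv X n : (deriv X n)^t* = deriv (X^t*) n.
Proof.
elim: n => [|n IH] /=; first by rewrite trmx0 map_mx0.
by rewrite trmxCD !trmxC_tens !trmxC1 IH.
Qed.

Lemma derivP s X Y n : deriv (s *: X + Y) n = s *: deriv X n + deriv Y n.
Proof.
elim: n => [|n IH] /=; first by rewrite scaler0 addr0.
by rewrite IH tensmxDl tensmxDr tensmxZl tensmxZr scalerDr addrACA.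
Qed.

Lemma deriv0 n : deriv 0 n = 0.
Proof. by elim: n => //= n ->; rewrite tens0mx tensmx0 addr0. Qed.

Lemma deriv_tv X psi n : deriv X n *m tv psi n = dtv psi (X *m psi) n.
Proof.
elim: n => [|n IH] /=; first by rewrite mul0mx.
by rewrite mulmxDl !mul_tensv IH !mul1mx.
Qed.

Lemma dtvP psi s chi chi' n :
  dtv psi (s *: chi + chi') n = s *: dtv psi chi n + dtv psi chi' n.
Proof.
elim: n => [|n IH] /=; first by rewrite scaler0 addr0.
by rewrite IH tensvDl tensvDr tensvZl tensvZr scalerDr addrACA.
Qed.

Lemma dtv0 psi n : dtv psi 0 n = 0.
Proof. by elim: n => //= n ->; rewrite tensv0l tensv0r addr0. Qed.

Lemma dtvZ psi s chi n : dtv psi (s *: chi) n = s *: dtv psi chi n.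
Proof. by rewrite -[s *: chi]addr0 dtvP dtv0 addr0. Qed.

Lemma dtv_sum psi (I : finType) (f : I -> 'cV[C]_d) n :
  dtv psi (\sum_i f i) n = \sum_i dtv psi (f i) n.
Proof.
elim/big_rec2: _ => [|i y z _ <-]; first by rewrite dtv0.
by rewrite -[f i]scale1r dtvP !scale1r.
Qed.

(** Euler's identity: [dtv psi chi n] is the derivative of the degree-n homogeneous map [tv] at psi
    in the direction chi. *)
Lemma dtv_id psi n : dtv psi psi n = n%:R *: tv psi n.
Proof.
elim: n => [|n IH] /=; first by rewrite scale0r.
by rewrite IH tensvZr -[X in X + _]scale1r -scalerDl -natr1 addrC.
Qed.

End tensor_powers.

(** * Polynomials vanishing on a circle, and the span of rank-one operators *)

Section infinitesimal_generators.
Variable R : realType.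
Local Notation C := R[i].

(** A polynomial with n coefficients and n distinct roots is zero; the first n values of [s]
    suffice. *)
Lemma coef_eq0_of_roots (F : idomainType) n (f : nat -> F) (s : nat -> F) :
  injective s -> (forall m, \sum_(k < n) s m ^+ k * f k = 0) ->
  forall k, (k < n)%N -> f k = 0.
Proof.
move=> s_inj fs0 k lt_kn; pose p := \poly_(j < n) f j.
suff p0 : p = 0 by move: (coef0 F k); rewrite -p0 coef_poly lt_kn.
apply: (@roots_geq_poly_eq0 _ _ [seq s i | i <- iota 0 n]).
- apply/allP => _ /mapP[m _ ->]; apply/rootP; rewrite horner_poly -[RHS](fs0 m).
  by apply: eq_bigr => j _; rewrite mulrC.
- by rewrite map_inj_uniq ?iota_uniq.
- by rewrite size_map size_iota size_poly.
Qed.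

(** The points ((1 - m^2) + 2 m i) / (1 + m^2) of the rational parametrization of the circle. The
    real part determines m^2, hence the natural number m. *)
Lemma unit_circle_infinite :
  {z : nat -> C | injective z & forall m, z m * (z m)^*%R = 1}.
Proof.
pose q m : R := 1 + m%:R ^+ 2.
have q_gt0 m : 0 < q m by rewrite ltr_pwDl ?sqr_ge0.
have q_neq0 m : q m != 0 by rewrite gt_eqF.
exists (fun m => ((2 - q m) / q m) +i* (m%:R * 2 / q m)).
  move=> m n [] /eqP; rewrite eqr_div// => /eqP qmn _.
  have {qmn} /addrI/eqP : q m = q n.
    by apply: (@mulfI _ 2); rewrite ?pnatr_eq0//; lra.
  by rewrite eqrXn2 ?ler0n// eqr_nat => /eqP.
move=> m; apply/eqP; rewrite eq_complex /=; apply/andP; split; apply/eqP.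
  by move: (q_neq0 m); rewrite /q => ?; field.
by ring.
Qed.

(** Polarization: every matrix unit is a combination of four rank-one matrices v v^t*. *)
Lemma rank1_span d (P : 'M[C]_d -> Prop) :
  (forall s A B, P A -> P B -> P (s *: A + B)) ->
  P 0 -> (forall v : 'cV[C]_d, v != 0 -> P (v *m v^t*)) -> forall X, P X.
Proof.
move=> Plin P0 Prank1.
have PD A B : P A -> P B -> P (A + B).
  by move=> PA PB; rewrite -[A]scale1r; exact: Plin.
have PZ s A : P A -> P (s *: A).
  by move=> PA; rewrite -[_ *: _]addr0; exact: Plin.
have PB A B : P A -> P B -> P (A - B).
  by move=> PA PB; rewrite -scaleN1r; apply: PD => //; exact: PZ.
have Pv (v : 'cV[C]_d) : P (v *m v^t*).
  by have [->|/Prank1//] := eqVneq v 0; rewrite mul0mx.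
have Pdelta a b : P (delta_mx a b).
  pose e a : 'cV[C]_d := delta_mx a 0.
  pose Q (s : C) := (e a + s *: e b) *m (e a + s *: e b)^t*.
  have QE s : Q s = delta_mx a a + (s^*)%R *: delta_mx a b
      + s *: delta_mx b a + (s * s^*%R) *: delta_mx b b.
    rewrite /Q trmxCD trmxCZ !trmxC_delta mulmxDl !mulmxDr.
    by rewrite -!scalemxAl -!scalemxAr !mul_delta_mx scalerA !addrA.
  (* The bracket is the sum of s Q(s) over the fourth roots of unity s. The sums of s, of s^2 and of
     s |s|^2 vanish and that of s conj(s) is 4, which isolates E_ab. *)
  have -> : delta_mx a b =
      4^-1 *: (Q 1 - Q (-1) + 'i%R *: (Q 'i%R - Q (- 'i%R))).
    have cN1 : (-1 : C)^*%R = -1 by rewrite rmorphN /= conjC1.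
    have cNi : (- 'i%R : C)^*%R = 'i%R by rewrite rmorphN /= conjCi opprK.
    rewrite !QE cN1 cNi conjCi conjC1.
    apply/matrixP => i j; rewrite !mxE.
    move: ((i == a) && (j == a))%:R ((i == a) && (j == b))%:R.
    move: ((i == b) && (j == a))%:R ((i == b) && (j == b))%:R => x y z t.
    have := @sqrCi C; set I := 'i%R => I2.
    (* The right-hand side expands to this with [I] a free symbol; I^2 = -1 enters only in the
       comparison with the left-hand side. *)
    transitivity (4^-1 * (t * (2 - 2 * I ^+ 2) + x * (2 + 2 * I ^+ 2))).
      by rewrite I2; field.
    by ring.
  have PQ s : P (Q s) by exact: Pv.
  exact: (PZ _ _ (PD _ _ (PB _ _ (PQ _) (PQ _)) (PZ _ _ (PB _ _ (PQ _) (PQ _))))).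
move=> X; rewrite (matrix_sum_delta X).
elim/big_ind: _ => // i _; elim/big_ind: _ => // j _; exact: PZ.
Qed.
End infinitesimal_generators.

(** * Pointwise commutator identity and the swap operator *)

Section derivation_identity.
Variables (R : realType) (d : nat).
Local Notation C := R[i].
Implicit Types (psi : 'cV[C]_d).

Lemma expval_deriv n X psi : psi^t* *m psi = 1%:M ->
  expval (deriv X n) (tv psi n) = n%:R * expval X psi.
Proof.
move=> psi1; elim: n => [|n IH] /=; first by rewrite expval0 mul0r.
rewrite expvalD !expval_tens IH !expval1 ?tv_unit// mulr1 mul1r.
by rewrite -natr1 mulrDl mul1r addrC.
Qed.

Lemma mul_delta_cV (a b : 'I_d) psi :
  delta_mx a b *m psi = psi b 0 *: delta_mx a 0.
Proof.
apply/matrixP => i j; rewrite [j]ord1 !mxE (bigD1 b) //= big1 ?addr0.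
  by rewrite !mxE !eqxx !andbT mulrC.
by move=> k kb; rewrite mxE (negbTE kb) andbF mul0r.
Qed.

Lemma sum_norm_unit psi : psi^t* *m psi = 1%:M ->
  \sum_a (psi a 0)^*%R * psi a 0 = 1.
Proof.
move=> psi1; have := expval1 psi1; rewrite /expval mulmx1 mxE => <-.
by apply: eq_bigr => a _; rewrite !mxE.
Qed.

(** Each commutator has four terms. Summed over c, E_cb E_ac = (a == b) E_cc gives the scalar term
    by unit norm, the terms with Y Gamma(E_ac) recombine into Y Gamma(E_ab), E_ac E_cb = E_ab occurs
    d times, and the terms with Gamma(E_ac) Y give n more copies of the same product by Euler's
    identity. *)
Lemma sum_commutator_deriv n psi (Y : 'M[C]_(pw d n)) (a b : 'I_d) :
  psi^t* *m psi = 1%:M ->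
  \sum_c expval ((delta_mx c b *t Y) *m deriv (delta_mx a c) n.+1 -
                 deriv (delta_mx a c) n.+1 *m (delta_mx c b *t Y))
                (tv psi n.+1) =
  expval (Y *m ((a == b)%:R%:M + deriv (delta_mx a b) n)) (tv psi n) -
  (d + n)%:R * (expval (delta_mx a b) psi * expval Y (tv psi n)).
Proof.
move=> psi1; have tv1 := tv_unit n psi1.
pose e a : 'cV[C]_d := delta_mx a 0.
(* E_ac psi = psi_c e_a, so on the ket side c enters only as a scalar and [k] is independent of it.
   On the bra side a and c trade places, so [l] keeps the index c. *)
have ket c : deriv (delta_mx a c) n *m tv psi n = psi c 0 *: dtv psi (e a) n.
  by rewrite deriv_tv mul_delta_cV dtvZ.
have bra c : (tv psi n)^t* *m deriv (delta_mx a c) n =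
    (psi a 0)^*%R *: (dtv psi (e c) n)^t*.
  rewrite -[deriv _ _]trmxCK -trmxC_mul trmxC_deriv trmxC_delta deriv_tv.
  by rewrite mul_delta_cV dtvZ trmxCZ.
set y := expval Y (tv psi n).
pose k := ((tv psi n)^t* *m Y *m dtv psi (e a) n) 0 0.
pose l c := ((dtv psi (e c) n)^t* *m Y *m tv psi n) 0 0.
have Yket c : expval (Y *m deriv (delta_mx a c) n) (tv psi n) = psi c 0 * k.
  by rewrite /expval -!mulmxA ket -!scalemxAr mxE mulmxA.
have braY c : expval (deriv (delta_mx a c) n *m Y) (tv psi n) =
    (psi a 0)^*%R * l c.
  by rewrite /expval mulmxA bra -!scalemxAl mxE.
(* The sum reassembles psi from its coordinates inside the linear slot of [dtv]. *)
have suml : \sum_c (psi c 0)^*%R * l c = n%:R * y.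
  have psiE : \sum_c psi c 0 *: e c = psi.
    rewrite [RHS]matrix_sum_delta; apply: eq_bigr => c _.
    by rewrite big_ord1.
  transitivity (((dtv psi (\sum_c psi c 0 *: e c) n)^t* *m Y *m tv psi n) 0 0).
    rewrite dtv_sum raddf_sum map_mx_sum !mulmx_suml summxE.
    apply: eq_bigr => c _; rewrite -[(_ *: e c)]/(_ *: e c) dtvZ trmxCZ.
    by rewrite -!scalemxAl [RHS]mxE.
  by rewrite psiE dtv_id trmxCZ rmorph_nat -!scalemxAl mxE.
rewrite (eq_bigr (fun c : 'I_d =>
   (a == b)%:R * y * ((psi c 0)^*%R * psi c 0)
   + (psi c 0)^*%R * psi c 0 * (psi b 0 * k)
   - expval (delta_mx a b) psi * y
   - (psi a 0)^*%R * psi b 0 * ((psi c 0)^*%R * l c))); last first.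
  move=> c _; rewrite /= mulmxDr mulmxDl !tensmx_mul !mul1mx !mulmx1.
  rewrite expvalB !expvalD !expval_tens Yket braY !expval_delta -/y.
  rewrite !mul_delta_mx_cond.
  rewrite eq_sym.
  rewrite eqxx mulr1n expval_delta.
  by case: (a == b); rewrite ?mulr1n ?mulr0n ?expval0 ?expval_delta; ring.
rewrite !sumrB big_split /= -mulr_sumr -mulr_suml sum_norm_unit//.
rewrite sumr_const card_ord -mulr_sumr suml.
rewrite mulmxDr expvalD Yket mul_mx_scalar expvalZ expval_delta -/y natrD.
by rewrite -mulr_natl; ring.
Qed.

(** The expectation of SWAP = sum of E_ab (x) E_ba in psi (x) phi. *)
Definition overlapC (psi phi : 'cV[C]_d) : C :=
  \sum_a \sum_b expval (delta_mx a b) psi * expval (delta_mx b a) phi.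

Lemma sqr_norm_overlapC psi phi :
  `|(psi^t* *m phi) 0 0| ^+ 2 = overlapC psi phi.
Proof.
rewrite normCK.
have -> : (psi^t* *m phi) 0 0 = \sum_a (psi a 0)^*%R * phi a 0.
  by rewrite mxE; apply: eq_bigr => a _; rewrite !mxE.
rewrite rmorph_sum mulr_suml; apply: eq_bigr => a _.
rewrite mulr_sumr; apply: eq_bigr => b _.
by rewrite rmorphM /= conjCK !expval_delta; ring.
Qed.

(* In matrix units, (d + N + M) 1 + sum_(i, j) SWAP_(i, j), where SWAP_(i, j)
   exchanges particle i of the first register and particle j of the second. *)
Definition swap_sum N M : 'M[C]_(pw d N * pw d M) :=
  \sum_a \sum_b ((a == b)%:R%:M + deriv (delta_mx a b) N) *t
                 ((b == a)%:R%:M + deriv (delta_mx b a) M).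

Lemma trmxC_swap_sum N M : (swap_sum N M)^t* = swap_sum N M.
Proof.
have scalar_nat D (k : nat) : (k%:R%:M : 'M[C]_D)^t* = k%:R%:M.
  by rewrite tr_scalar_mx map_scalar_mx /= rmorph_nat.
rewrite /swap_sum raddf_sum map_mx_sum exchange_big; apply: eq_bigr => a _.
rewrite raddf_sum map_mx_sum; apply: eq_bigr => b _.
rewrite trmxC_tens !trmxCD !trmxC_deriv !trmxC_delta.
by rewrite !scalar_nat [b == a]eq_sym.
Qed.

(** On expanding the product, the two Kronecker deltas give d, the mixed terms give N and M because
    the E_aa sum to the identity, and the two derivations give N M overlaps. *)
Lemma expval_swap_sum N M psi phi :
  psi^t* *m psi = 1%:M -> phi^t* *m phi = 1%:M ->
  expval (swap_sum N M) (tensv (tv psi N) (tv phi M)) =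
  (d + N + M)%:R + (N * M)%:R * overlapC psi phi.
Proof.
move=> psi1 phi1.
have tvN := tv_unit N psi1; have tvM := tv_unit M phi1.
have E (x : 'cV[C]_d) n a b : x^t* *m x = 1%:M ->
    expval ((a == b)%:R%:M + deriv (delta_mx a b) n) (tv x n) =
    (a == b)%:R + n%:R * expval (delta_mx a b) x.
  move=> x1; rewrite expvalD expval_deriv // -scalemx1 expvalZ expval1 ?mulr1//.
  exact: tv_unit.
have sum1 (x : 'cV[C]_d) : x^t* *m x = 1%:M ->
    \sum_a expval (delta_mx a a) x = 1.
  move=> x1; rewrite -[RHS](sum_norm_unit x1).
  by apply: eq_bigr => a _; rewrite expval_delta.
transitivity (\sum_a (1 + N%:R * expval (delta_mx a a) psi +
    M%:R * expval (delta_mx a a) phi + (N * M)%:R *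
    \sum_b expval (delta_mx a b) psi * expval (delta_mx b a) phi) : C).
  rewrite /swap_sum expval_sum; apply: eq_bigr => a _; rewrite expval_sum.
  rewrite (bigD1 a) //= [in RHS](bigD1 a) //= expval_tens !E // eqxx mulr1n.
  rewrite [in RHS]mulrDr [RHS]addrA; congr (_ + _); first by rewrite natrM; ring.
  rewrite mulr_sumr; apply: eq_bigr => b ba; rewrite expval_tens !E //.
  by rewrite eq_sym (negbTE ba) mulr0n natrM; ring.
rewrite !big_split /= -!mulr_sumr !sum1 // sumr_const card_ord /overlapC.
by rewrite !natrD; ring.
Qed.

End derivation_identity.

(** * Expectations of bounded complex random variables *)

Section bounded_measurable.
Context (dp : measure_display) (T : measurableType dp) (R : realType).
Implicit Types f g : T -> R.

(** A class closed under products as well as sums, and integrable for every probability. *)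
Definition bmeas f := measurable_fun setT f /\ exists K, forall x, `|f x| <= K.

Lemma bmeas_cst (r : R) : bmeas (fun=> r).
Proof. by split; [exact: measurable_cst | exists `|r|]. Qed.

Lemma bmeasD f g : bmeas f -> bmeas g -> bmeas (fun x => f x + g x).
Proof.
move=> [mf [K Kf]] [mg [L Lg]]; split; first exact: measurable_funD.
by exists (K + L) => x; rewrite (le_trans (ler_normD _ _))// lerD.
Qed.

Lemma bmeasN f : bmeas f -> bmeas (fun x => - f x).
Proof.
move=> [mf [K Kf]]; split; last by exists K => x; rewrite normrN.
exact: measurableT_comp.
Qed.

Lemma bmeasB f g : bmeas f -> bmeas g -> bmeas (fun x => f x - g x).
Proof. by move=> bf bg; apply: bmeasD => //; exact: bmeasN. Qed.

Lemma bmeasM f g : bmeas f -> bmeas g -> bmeas (fun x => f x * g x).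
Proof.
move=> [mf [K Kf]] [mg [L Lg]]; split; first exact: measurable_funM.
by exists (K * L) => x; rewrite normrM ler_pM.
Qed.

Lemma bmeas_integrable (P : probability T R) f :
  bmeas f -> P.-integrable setT (EFin \o f).
Proof.
move=> [mf [K Kf]]; apply: measurable_bounded_integrable => //.
  by apply: (le_lt_trans (probability_le1 P measurableT)); rewrite ltry.
exists K; split => [|M KM x _ /=]; rewrite ?num_real//.
exact: le_trans (Kf x) (ltW KM).
Qed.

End bounded_measurable.

Lemma bmeas_comp (R : realType) (d1 d2 : measure_display)
    (T1 : measurableType d1) (T2 : measurableType d2) (h : T1 -> T2)
    (f : T2 -> R) :
  measurable_fun setT h -> bmeas f -> bmeas (fun x => f (h x)).
Proof.
move=> mh [mf [K Kf]]; split; last by exists K => x.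
exact: measurableT_comp.
Qed.


Section complex_expectation.
Context (dp : measure_display) (T : measurableType dp) (R : realType).
Local Notation C := R[i].
Implicit Types f g : T -> C.

Definition cbmeas f :=
  bmeas (fun x => complex.Re (f x)) /\ bmeas (fun x => complex.Im (f x)).

Lemma cbmeas_cst (c : C) : cbmeas (fun=> c).
Proof. by split; exact: bmeas_cst. Qed.

Lemma cbmeasD f g : cbmeas f -> cbmeas g -> cbmeas (fun x => f x + g x).
Proof.
move=> [rf jf] [rg jg]; split.
  by under [X in bmeas X]eq_fun do rewrite raddfD; exact: bmeasD.
by under [X in bmeas X]eq_fun do rewrite raddfD; exact: bmeasD.
Qed.

Lemma ReM (x y : C) : complex.Re (x * y) =
  complex.Re x * complex.Re y - complex.Im x * complex.Im y.
Proof. by case: x y => [? ?] [? ?]. Qed.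

Lemma ImM (x y : C) : complex.Im (x * y) =
  complex.Re x * complex.Im y + complex.Im x * complex.Re y.
Proof. by case: x y => [? ?] [? ?]. Qed.

Lemma cbmeasM f g : cbmeas f -> cbmeas g -> cbmeas (fun x => f x * g x).
Proof.
move=> [rf jf] [rg jg]; split.
  by under [X in bmeas X]eq_fun do rewrite ReM; apply: bmeasB; exact: bmeasM.
by under [X in bmeas X]eq_fun do rewrite ImM; apply: bmeasD; exact: bmeasM.
Qed.

Lemma cbmeas_conj f : cbmeas f -> cbmeas (fun x => (f x)^*%R).
Proof.
move=> [rf jf]; split.
  rewrite (_ : (fun x => _) = fun x => complex.Re (f x)) //.
  by apply/funext => x; case: (f x).
rewrite (_ : (fun x => _) = fun x => - complex.Im (f x)); first exact: bmeasN.
by apply/funext => x; case: (f x).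
Qed.

Lemma cbmeas_sum (I : finType) (f : I -> T -> C) :
  (forall i, cbmeas (f i)) -> cbmeas (fun x => \sum_i f i x).
Proof.
move=> bf; rewrite (_ : (fun x => _) = \sum_i f i); last first.
  by apply/funext => x; rewrite fct_sumE.
elim/big_ind: _ => //; first exact: cbmeas_cst.
by move=> g h; exact: cbmeasD.
Qed.

Variable P : probability T R.

(** The real integrals are total, with default values when not finite; the linearity lemmas
    therefore ask for [cbmeas]. *)
Definition cexp f : C :=
  (\int[P]_x complex.Re (f x)) +i* (\int[P]_x complex.Im (f x)).

Lemma cexp_cst c : cexp (fun=> c) = c.
Proof.
rewrite /cexp !Rintegral_cst//= !probability_setT !mulr1.
by case: c.
Qed.

Lemma cexpD f g : cbmeas f -> cbmeas g ->
  cexp (fun x => f x + g x) = cexp f + cexp g.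
Proof.
move=> [rf jf] [rg jg]; apply/eqP; rewrite eq_complex /=.
rewrite -!RintegralD //; do ?exact: bmeas_integrable.
by apply/andP; split; apply/eqP; apply: eq_Rintegral => x _; rewrite raddfD.
Qed.

Lemma cexpZ c f : cbmeas f -> cexp (fun x => c * f x) = c * cexp f.
Proof.
move=> [rf jf]; apply/eqP; rewrite eq_complex ReM ImM /=.
rewrite -!RintegralZl //; do ?exact: bmeas_integrable.
rewrite -RintegralB // -?RintegralD //;
  do ?by apply: bmeas_integrable; apply: bmeasM => //; exact: bmeas_cst.
by apply/andP; split; apply/eqP; apply: eq_Rintegral => x _;
  rewrite ?ReM ?ImM.
Qed.

Lemma cexp_sum (I : finType) (f : I -> T -> C) :
  (forall i, cbmeas (f i)) ->
  cexp (fun x => \sum_i f i x) = \sum_i cexp (f i).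
Proof.
move=> bf.
have H (s : seq I) : cbmeas (fun x => \sum_(i <- s) f i x) /\
    cexp (fun x => \sum_(i <- s) f i x) = \sum_(i <- s) cexp (f i).
  elim: s => [|i s [IH1 IH2]].
    under [X in cbmeas X]eq_fun do rewrite big_nil.
    under [X in cexp X]eq_fun do rewrite big_nil.
    by rewrite big_nil cexp_cst; split => //; exact: cbmeas_cst.
  under [X in cbmeas X]eq_fun do rewrite big_cons.
  under [X in cexp X]eq_fun do rewrite big_cons.
  by rewrite big_cons -IH2 cexpD //; split => //; exact: cbmeasD.
exact: (H _).2.
Qed.

End complex_expectation.

(** * Fubini for products of independent variables *)

Section independence.
Context (d1 d2 : measure_display) (T1 : measurableType d1)
  (T2 : measurableType d2) (R : realType).
Variables (P1 : probability T1 R) (P2 : probability T2 R).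

Lemma bmeas_tens (f : T1 -> R) (g : T2 -> R) :
  bmeas f -> bmeas g -> bmeas (fun w : T1 * T2 => f w.1 * g w.2).
Proof.
move=> bf bg; apply: bmeasM.
  by apply: (bmeas_comp _ bf); exact: measurable_fst.
by apply: (bmeas_comp _ bg); exact: measurable_snd.
Qed.

Lemma integrable_tens (f : T1 -> R) (g : T2 -> R) : bmeas f -> bmeas g ->
  (P1 \x P2)%E.-integrable setT (EFin \o (fun w => f w.1 * g w.2)).
Proof. by move=> bf bg; exact: (bmeas_integrable _ (bmeas_tens bf bg)). Qed.

Lemma Rintegral_tens (f : T1 -> R) (g : T2 -> R) : bmeas f -> bmeas g ->
  \int[(P1 \x P2)%E]_w (f w.1 * g w.2) = (\int[P1]_x f x) * (\int[P2]_y g y).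
Proof.
move=> bf bg.
rewrite -RintegralZr //; last exact: bmeas_integrable.
rewrite /Rintegral; congr fine.
have bfg := bmeas_tens bf bg.
rewrite -(integral12_prod_meas1 (f := EFin \o (fun w => f w.1 * g w.2))) /=;
  last exact: (bmeas_integrable (P1 \x P2)%E).
apply: eq_integral => x _; rewrite /fubini_F /=.
under eq_integral do rewrite EFinM.
rewrite integralZl //; last exact: bmeas_integrable.
rewrite EFinM fineK //; apply: integrable_fin_num => //.
exact: bmeas_integrable.
Qed.

Lemma cbmeas_fst (f : T1 -> R[i]) :
  cbmeas f -> cbmeas (fun w : T1 * T2 => f w.1).
Proof.
move=> [rf jf]; split; first exact: (bmeas_comp measurable_fst rf).
exact: (bmeas_comp measurable_fst jf).
Qed.

Lemma cbmeas_snd (f : T2 -> R[i]) :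
  cbmeas f -> cbmeas (fun w : T1 * T2 => f w.2).
Proof.
move=> [rf jf]; split; first exact: (bmeas_comp measurable_snd rf).
exact: (bmeas_comp measurable_snd jf).
Qed.

Lemma cexp_tens (f : T1 -> R[i]) (g : T2 -> R[i]) : cbmeas f -> cbmeas g ->
  cexp (P1 \x P2)%E (fun w => f w.1 * g w.2) = cexp P1 f * cexp P2 g.
Proof.
move=> [rf jf] [rg jg]; apply/eqP; rewrite eq_complex ReM ImM /=.
rewrite -!Rintegral_tens //.
rewrite -(RintegralB measurableT (integrable_tens rf rg) (integrable_tens jf jg)).
rewrite -(RintegralD measurableT (integrable_tens rf jg) (integrable_tens jf rg)).
by apply/andP; split; apply/eqP; apply: eq_Rintegral => x _;
  rewrite ?ReM ?ImM.
Qed.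

End independence.

(** * Haar moments *)

Section haar_invariance.
Variables (R : realType) (d : nat).
Local Notation C := R[i].
Local Notation G := (SU R d).

Lemma SU_continuous_measurable (f : G -> R) : continuous f ->
  measurable_fun setT f.
Proof.
move=> /continuousP cf; apply: (measurability _ (RGenOpens.measurableE R)).
move=> _ [_ [a [b ->] <-]]; rewrite setTI.
by apply: sub_sigma_algebra; exact/cf/interval_open.
Qed.

Lemma Re_continuous : continuous (@complex.Re R).
Proof.
move=> z A /nbhs_ballP[e e0 eA]; apply/nbhs_ballP; exists e%:C.
  by rewrite /= ltcR.
move=> y zy; apply: eA; move: zy; rewrite /ball /= /ball /= -raddfB => zy.
by rewrite -ltcR (le_lt_trans (normc_ge_Re _)).
Qed.

Lemma Im_continuous : continuous (@complex.Im R).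
Proof.
move=> z A /nbhs_ballP[e e0 eA]; apply/nbhs_ballP; exists e%:C.
  by rewrite /= ltcR.
move=> y zy; apply: eA; move: zy; rewrite /ball /= /ball /= -raddfB => zy.
rewrite -ltcR -normrN -ReiNIm (le_lt_trans (normc_ge_Re _))// normrM.
by rewrite complexiE normCi mulr1.
Qed.

Lemma mulmx_continuous (g : 'M[C]_d) : continuous (fun A : 'M[C]_d => g *m A).
Proof.
move=> A B /nbhs_ballP[e e0 eB]; apply/nbhs_ballP.
(* [K] exceeds every row sum of |g|; the leading 1 makes it positive and the final estimate
   strict. *)
pose K : C := 1 + \sum_i \sum_k `|g i k|.
have sum_ge0 : 0 <= \sum_i \sum_k `|g i k|.
  by apply: sumr_ge0 => i _; apply: sumr_ge0.
have K0 : 0 < K by rewrite ltr_pwDl.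
exists (e / K); first by rewrite /= divr_gt0.
move=> A' [_ AA']; apply: eB; split => // i j.
have {}AA' k : `|A k j - A' k j| < e / K by exact: AA'.
rewrite /ball /= !mxE -sumrB.
rewrite (le_lt_trans (ler_norm_sum _ _ _))//.
apply: (@le_lt_trans _ _ (\sum_k `|g i k| * (e / K))).
  apply: ler_sum => k _; rewrite -mulrBr normrM ler_wpM2l//.
  exact: ltW.
rewrite -mulr_suml mulrCA gtr_pMr// ltr_pdivrMr// mul1r.
rewrite ltr_pwDl// [leRHS](bigD1 i)//= lerDl.
by apply: sumr_ge0 => k _; apply: sumr_ge0.
Qed.

Lemma mulg_measurable (g : G) : measurable_fun setT (fun u : G => (g * u)%g).
Proof.
have cg : continuous (fun u : G => (g * u)%g).
  apply: continuous_comp_initial => u /=.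
  apply: (@continuous_comp _ _ _ (@su_mx R d) (fun A => su_mx g *m A)).
    exact: initial_continuous.
  exact: mulmx_continuous.
apply: (measurability _ (erefl (@measurable _ G))).
move=> _ [A oA <-]; rewrite setTI.
by apply: sub_sigma_algebra; move/continuousP: cg; exact.
Qed.

(** Rows of a unitary matrix have norm one, and a single squared modulus is at most the whole
    sum. *)
Lemma unitary_entry_bound (g : G) i j : `|su_mx g i j| <= 1.
Proof.
have /unitarymxP/matrixP/(_ i i) := su_unitary g.
rewrite !mxE eqxx mulr1n => sum1.
rewrite -(ler_pXn2r (n := 2)) ?nnegrE// expr1n -[leRHS]sum1 (bigD1 j) //=.
rewrite !mxE -normCK lerDl sumr_ge0// => k _.
by rewrite !mxE -normCK exprn_ge0.
Qed.

Lemma normc_ge_Im (x : C) : `|complex.Im x|%:C <= `|x|.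
Proof.
rewrite -[complex.Im x]opprK normrN -ReiNIm (le_trans (normc_ge_Re _))// normrM.
by rewrite complexiE normCi mulr1.
Qed.

Lemma cbmeas_entry i j : cbmeas (fun u : G => su_mx u i j).
Proof.
have c (h : C -> R) : continuous h -> continuous (fun u : G => h (su_mx u i j)).
  move=> ch u; apply: (@continuous_comp _ _ _ (@su_mx R d) (fun A => h (A i j))).
    exact: initial_continuous.
  apply: (@continuous_comp _ _ _ (fun A : 'M[C]_d => A i j) h); last exact: ch.
  exact: coord_continuous.
split; split.
- by apply: SU_continuous_measurable; apply: c; exact: Re_continuous.
- exists 1 => u; rewrite -lecR (le_trans (normc_ge_Re _))//.
  exact: unitary_entry_bound.
- by apply: SU_continuous_measurable; apply: c; exact: Im_continuous.
- exists 1 => u; rewrite -lecR (le_trans (normc_ge_Im _))//.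
  exact: unitary_entry_bound.
Qed.

Variable haar : probability G R.
Hypothesis haarP : haar_probability haar.

(** Change of variables: the pushforward of [haar] under left translation agrees with [haar] on
    measurable sets. *)
Lemma haar_Rintegral_mulg (f : G -> R) (g : G) : bmeas f ->
  \int[haar]_u f (g * u)%g = \int[haar]_u f u.
Proof.
move=> [mf [K Kf]]; rewrite /Rintegral; congr fine.
have mg := mulg_measurable g.
have bfg : bmeas (fun u => f (g * u)%g).
  exact: bmeas_comp mg (conj mf (ex_intro _ K Kf)).
transitivity (\int[pushforward haar (fun u : G => (g * u)%g)]_u (f u)%:E)%E.
  rewrite (integral_pushforward mg (f := EFin \o f)) //.
  - exact/measurable_EFinP.
  - exact: bmeas_integrable.
apply: eq_measure_integral => A mA _.
exact: haarP.
Qed.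

Lemma cexp_mulg (f : G -> C) (g : G) : cbmeas f ->
  cexp haar (fun u => f (g * u)%g) = cexp haar f.
Proof.
move=> [rf jf]; rewrite /cexp; congr (_ +i* _).
  exact: (haar_Rintegral_mulg g rf).
exact: (haar_Rintegral_mulg g jf).
Qed.

End haar_invariance.

(** * Moments of Haar-random pure states *)

Section haar_moments.
Variables (R : realType) (d : nat) (haar : probability (SU R d) R).
Variable ket0 : 'cV[R[i]]_d.
Hypothesis d_gt0 : (0 < d)%N.
Hypothesis haarP : haar_probability haar.
Hypothesis ket0_unit : ket0^t* *m ket0 = 1%:M.
Local Notation C := R[i].
Local Notation G := (SU R d).
Local Notation ket u := (su_mx u *m ket0).

Lemma ket_unit (u : G) : (ket u)^t* *m ket u = 1%:M.
Proof.
rewrite trmxC_mul -mulmxA (mulmxA _ (su_mx u)).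
by rewrite (mulmx1C (unitarymxP (su_unitary u))) mul1mx.
Qed.

Lemma cbmeas_ket i : cbmeas (fun u : G => (ket u) i 0).
Proof.
under [X in cbmeas X]eq_fun do rewrite mxE.
apply: cbmeas_sum => j; apply: cbmeasM; last exact: cbmeas_cst.
exact: cbmeas_entry.
Qed.

Lemma cbmeas_tv n i : cbmeas (fun u : G => tv (ket u) n i 0).
Proof.
elim: n i => [|n IH] i; first exact: cbmeas_cst.
under [X in cbmeas X]eq_fun do rewrite /= tensvE.
by apply: cbmeasM; [exact: cbmeas_ket | exact: IH].
Qed.

Lemma cbmeas_expval (dp : measure_display) (T : measurableType dp) D
    (x : T -> 'cV[C]_D) (A : 'M[C]_D) :
  (forall i, cbmeas (fun t => x t i 0)) -> cbmeas (fun t => expval A (x t)).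
Proof.
move=> bx; rewrite /expval.
under [X in cbmeas X]eq_fun do rewrite mxE.
apply: cbmeas_sum => j; apply: cbmeasM; last exact: bx.
under [X in cbmeas X]eq_fun do rewrite mxE.
apply: cbmeas_sum => k; apply: cbmeasM; last exact: cbmeas_cst.
under [X in cbmeas X]eq_fun do rewrite !mxE.
exact: cbmeas_conj.
Qed.

Lemma cbmeas_expval_tv n A : cbmeas (fun u : G => expval A (tv (ket u) n)).
Proof. by apply: cbmeas_expval => i; exact: cbmeas_tv. Qed.

Lemma cbmeas_expval_ket A : cbmeas (fun u : G => expval A (ket u)).
Proof. by apply: cbmeas_expval => i; exact: cbmeas_ket. Qed.

(** The linear functional A -> tr(A rho), where rho is the averaged state of n copies. *)
Definition moment n (A : 'M[C]_(pw d n)) : C :=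
  cexp haar (fun u => expval A (tv (ket u) n)).

Lemma momentP n s (A B : 'M[C]_(pw d n)) :
  moment (s *: A + B) = s * moment A + moment B.
Proof.
rewrite /moment -cexpZ; last exact: cbmeas_expval_tv.
rewrite -cexpD; [|apply: cbmeasM; first exact: cbmeas_cst|];
  do ?exact: cbmeas_expval_tv.
by congr cexp; apply/funext => u; rewrite expvalD expvalZ.
Qed.

Lemma moment0 n : moment (0 : 'M[C]_(pw d n)) = 0.
Proof.
rewrite /moment -[RHS](cexp_cst haar); congr cexp; apply/funext => u.
by rewrite expval0.
Qed.

Lemma momentD n (A B : 'M[C]_(pw d n)) : moment (A + B) = moment A + moment B.
Proof. by rewrite -[A]scale1r momentP mul1r scale1r. Qed.

Lemma momentZ n s (A : 'M[C]_(pw d n)) : moment (s *: A) = s * moment A.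
Proof. by rewrite -[s *: A]addr0 momentP moment0 addr0. Qed.

Lemma momentB n (A B : 'M[C]_(pw d n)) : moment (A - B) = moment A - moment B.
Proof. by rewrite -scaleN1r momentD momentZ mulN1r. Qed.

Lemma moment_sum n (I : finType) (A : I -> 'M[C]_(pw d n)) :
  moment (\sum_i A i) = \sum_i moment (A i).
Proof.
elim/big_rec2: _ => [|i y z _ <-]; first exact: moment0.
exact: momentD.
Qed.

Lemma moment1 n : moment (1%:M : 'M[C]_(pw d n)) = 1.
Proof.
rewrite /moment -[RHS](cexp_cst haar); congr cexp; apply/funext => u.
by rewrite expval1 //; apply: tv_unit; exact: ket_unit.
Qed.

Lemma moment_SU n (g : G) (A : 'M[C]_(pw d n)) :
  moment ((tp (su_mx g) n)^t* *m A *m tp (su_mx g) n) = moment A.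
Proof.
rewrite /moment -[RHS](cexp_mulg haarP g); last exact: cbmeas_expval_tv.
congr cexp; apply/funext => u; rewrite -expval_mulmx tp_mul_tv.
by rewrite mulmxA.
Qed.

(* A unitary matrix is a phase times an element of SU(d), and the phase
   drops out of the conjugation by its tensor power. *)
Lemma moment_unitary n (g : 'M[C]_d) (A : 'M[C]_(pw d n)) : g \is unitarymx ->
  moment ((tp g n)^t* *m A *m tp g n) = moment A.
Proof.
move=> gU; pose l : C := d.-root (\det g)^-1.
have ld : l ^+ d = (\det g)^-1 by rewrite rootCK.
have detg : `|\det g| = 1.
  have /(congr1 determinant) := unitarymxP gU.
  rewrite det_mulmx det1 det_map_mx det_tr -normCK => /eqP.
  by rewrite sqrp_eq1 // => /eqP.
have detg0 : \det g != 0 by rewrite -normr_eq0 detg oner_eq0.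
have l1 : `|l| = 1.
  apply/eqP; rewrite -(@pexpr_eq1 _ _ d) // -normrX ld normfV detg invr1.
  by rewrite eqxx.
have lgP : (l *: g \is unitarymx) && (\det (l *: g) == 1).
  apply/andP; split; last by rewrite detZ ld mulVf.
  apply/unitarymxP; rewrite trmxCZ -scalemxAl -scalemxAr scalerA -normCK l1.
  by rewrite expr1n scale1r; exact/unitarymxP.
have ll1 : (l ^+ n)^*%R * l ^+ n = 1.
  by rewrite mulrC -normCK normrX l1 !expr1n.
rewrite -[RHS](moment_SU (MkSU lgP)) /= tpZ trmxCZ -!scalemxAl -scalemxAr scalerA.
by rewrite ll1 scale1r.
Qed.

(** Conjugation by g^(x)n turns g^(x)n A into A g^(x)n, so both have the same moment. *)
Lemma moment_commute_unitary n (g : 'M[C]_d) (A : 'M[C]_(pw d n)) :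
  g \is unitarymx -> moment (A *m tp g n - tp g n *m A) = 0.
Proof.
move=> gU; rewrite momentB -(moment_unitary (tp g n *m A) gU) mulmxA.
by rewrite trmxC_tp tpM (mulmx1C (unitarymxP gU)) tp1 mul1mx subrr.
Qed.

(* The unitaries 1 + s v v^* with s ranging over infinitely many points of a
   circle: the first-order coefficient in s of a polynomial identity. *)
Lemma moment_commute_rank1 n (v : 'cV[C]_d) (A : 'M[C]_(pw d n)) : v != 0 ->
  moment (A *m deriv (v *m v^t*) n - deriv (v *m v^t*) n *m A) = 0.
Proof.
move=> v0; set X := v *m v^t*.
pose nv : C := (v^t* *m v) 0 0.
have vv : v^t* *m v = nv%:M by rewrite [LHS]mx11_scalar.
have nvE : nv = \sum_i `|v i 0| ^+ 2.
  by rewrite /nv mxE; apply: eq_bigr => i _; rewrite !mxE normCK mulrC.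
have nv_ge0 : 0 <= nv by rewrite nvE sumr_ge0 // => i _; rewrite exprn_ge0.
have nv_neq0 : nv != 0.
  apply: contra v0; rewrite nvE psumr_eq0 => [/allP v0|i _]; last first.
    by rewrite exprn_ge0.
  apply/eqP/matrixP => i j; rewrite [j]ord1 mxE; apply/eqP.
  have := v0 i (mem_index_enum i).
  by rewrite /= expf_eq0 /= normr_eq0.
have XX : X *m X = nv *: X.
  by rewrite /X mulmxA -(mulmxA v) vv mul_mx_scalar -scalemxAl.
have XC : X^t* = X by rewrite /X trmxC_mul trmxCK.
have [z z_inj zz] := unit_circle_infinite R.
(* Since X^2 = [nv] X with X hermitian, 1 + s X is unitary as soon as 1 + s [nv] lies on the unit
   circle. *)
pose s m := (z m - 1) / nv.
have s_inj : injective s.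
  by move=> m m' /(mulIf (invr_neq0 nv_neq0)) /addIr /z_inj.
have gU m : 1%:M + s m *: X \is unitarymx.
  apply/unitarymxP; rewrite trmxCD trmxC1 trmxCZ XC.
  rewrite mulmxDl !mulmxDr !mul1mx mulmx1 -scalemxAl -scalemxAr XX !scalerA.
  rewrite -!addrA -[RHS]addr0; congr (_ + _); rewrite -!scalerDl.
  rewrite (_ : _ + _ = 0) ?scale0r //.
  have nvJ : nv^*%R = nv by apply/CrealP; exact: ger0_real.
  rewrite /s rmorphM fmorphV /= nvJ rmorphB /= conjC1.
  have := zz m; set w := (z m)^*%R => zw.
  transitivity ((z m * w - 1) / nv); first by field.
  by rewrite zw subrr mul0r.
rewrite -tpcoef1.
(* The zeroth tensor power has no coefficient of index 1 in range; its derivation is zero. *)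
case: n A => [|n] A; first by rewrite /= mulmx0 mul0mx subrr moment0.
pose f k := moment (A *m tpcoef X n.+1 k - tpcoef X n.+1 k *m A).
apply: (@coef_eq0_of_roots _ n.+2 f s) => // m.
rewrite -[RHS](moment_commute_unitary A (gU m)) tp_1D.
rewrite mulmx_sumr mulmx_suml -sumrB moment_sum; apply: eq_bigr => k _.
by rewrite -scalemxAl -scalemxAr -scalerBr momentZ.
Qed.

(** The identity is linear in X, so the rank-one case extends to all X by polarization. *)
Lemma moment_commute_deriv n (X : 'M[C]_d) (A : 'M[C]_(pw d n)) :
  moment (A *m deriv X n - deriv X n *m A) = 0.
Proof.
move: X; apply: rank1_span => [s X Y IHX IHY||v v0].
- rewrite derivP mulmxDl mulmxDr -scalemxAl -scalemxAr opprD addrACA -scalerBr.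
  by rewrite momentP IHX IHY mulr0 addr0.
- by rewrite deriv0 mul0mx mulmx0 subrr moment0.
- exact: moment_commute_rank1.
Qed.

(* Integration by parts on the sphere. *)
Lemma moment_rec n (Y : 'M[C]_(pw d n)) (a b : 'I_d) :
  cexp haar (fun u => expval (delta_mx a b) (ket u) *
                      expval Y (tv (ket u) n)) =
  (d + n)%:R^-1 * moment (Y *m ((a == b)%:R%:M + deriv (delta_mx a b) n)).
Proof.
have dn0 : (d + n)%:R != 0 :> C.
  by rewrite pnatr_eq0 addn_eq0 negb_and -lt0n d_gt0.
have bm : cbmeas (fun u => expval (delta_mx a b) (ket u) *
                      expval Y (tv (ket u) n)).
  by apply: cbmeasM; [exact: cbmeas_expval_ket | exact: cbmeas_expval_tv].
apply: (mulfI dn0); rewrite mulrA divff // mul1r.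
apply/eqP; rewrite -subr_eq0 -oppr_eq0 opprB; apply/eqP.
rewrite -cexpZ // /moment -mulN1r -cexpZ; last first.
  by apply: cbmeasM => //; exact: cbmeas_cst.
rewrite -cexpD; [|exact: cbmeas_expval_tv|]; last first.
  by do 2 (apply: cbmeasM; first exact: cbmeas_cst).
(* On unit vectors the difference of the two sides is a sum of commutators, each of zero moment. *)
transitivity (cexp haar (fun u => \sum_c expval
    ((delta_mx c b *t Y) *m deriv (delta_mx a c) n.+1 -
     deriv (delta_mx a c) n.+1 *m (delta_mx c b *t Y)) (tv (ket u) n.+1))).
  congr cexp; apply/funext => u; rewrite mulN1r.
  by rewrite sum_commutator_deriv //; exact: ket_unit.
rewrite cexp_sum; last by move=> c; exact: (cbmeas_expval_tv (n := n.+1)).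
by rewrite big1 // => c _; exact: (moment_commute_deriv (n := n.+1)).
Qed.

End haar_moments.

(** * Moments of the overlap *)

Lemma mxtens_castmx (K : pzRingType) m n p q m' n' p' q'
    (em : m = m') (en : n = n') (ep : p = p') (eq : q = q')
    (A : 'M[K]_(m, n)) (B : 'M[K]_(p, q)) :
  castmx (em, en) A *t castmx (ep, eq) B =
  castmx (f_equal2 muln em ep, f_equal2 muln en eq) (A *t B).
Proof.
by case: _ / em; case: _ / en; case: _ / ep; case: _ / eq; rewrite !castmx_id.
Qed.

Lemma ntensmx_tv (R : realType) d (psi : 'cV[R[i]]_d) n
    (e : pw d n = (d ^ n)%N) (e1 : 1%N = (1 ^ n)%N) :
  ntensmx psi n = castmx (e, e1) (tv psi n).
Proof.
(* [ntensmxSS] peels off a factor only if another remains, so the exponents 0 and 1 are both base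
   cases. The dimension equalities stay quantified to let the induction hypothesis be cast
   freely. *)
case: n e e1 => [|n] e e1; first by rewrite [RHS]castmx_id.
elim: n e e1 => [|n IH] e e1.
  rewrite ntensmx1 /= /tensv tens_mx_scalar scale1r castmx_comp.
  by rewrite [RHS]castmx_id.
have e' : pw d n.+1 = (d ^ n.+1)%N by elim: (n.+1) => //= k ->; rewrite expnS.
have e1' : 1%N = (1 ^ n.+1)%N by rewrite exp1n.
rewrite ntensmxSS (IH e' e1') -[X in X *t castmx _ _](castmx_id (erefl, erefl)).
rewrite mxtens_castmx.
congr (castmx (_, _)); exact: nat_irrelevance.
Qed.

Lemma joint_state_tv (R : realType) d N M (psi phi : 'cV[R[i]]_d)
    (e : (pw d N * pw d M)%N = (d ^ (N + M))%N) :
  joint_state N M psi phi = castmx (e, erefl 1%N) (tensv (tv psi N) (tv phi M)).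
Proof.
have pwE n : pw d n = (d ^ n)%N by elim: n => //= n ->; rewrite expnS.
have pw1 n : 1%N = (1 ^ n)%N by rewrite exp1n.
rewrite /joint_state (ntensmx_tv psi (pwE N) (pw1 N)).
rewrite (ntensmx_tv phi (pwE M) (pw1 M)) mxtens_castmx castmx_comp.
congr (castmx (_, _)); exact: nat_irrelevance.
Qed.

(** * Posterior identity for two registers and the first two overlap moments *)

Section two_registers.
Variables (R : realType) (d : nat) (haar : probability (SU R d) R).
Variable ket0 : 'cV[R[i]]_d.
Hypothesis d_gt0 : (0 < d)%N.
Hypothesis haarP : haar_probability haar.
Hypothesis ket0_unit : ket0^t* *m ket0 = 1%:M.
Local Notation C := R[i].
Local Notation G := (SU R d).
Local Notation ket u := (su_mx u *m ket0).
Local Notation hh := (haar \x haar)%E.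
Local Notation ov w := (overlapC (ket w.1) (ket w.2)).
Local Notation reg N M w := (tensv (tv (ket w.1) N) (tv (ket w.2) M)).
Local Notation moment := (moment haar ket0).

Lemma cbmeas_reg N M i : cbmeas (fun w : G * G => reg N M w i 0).
Proof.
under [X in cbmeas X]eq_fun do rewrite tensvE.
apply: cbmeasM; first exact: (cbmeas_fst _ (cbmeas_tv _ _)).
exact: (cbmeas_snd _ (cbmeas_tv _ _)).
Qed.

Lemma cbmeas_ov : cbmeas (fun w : G * G => ov w).
Proof.
apply: cbmeas_sum => a; apply: cbmeas_sum => b.
apply: cbmeasM; first exact: (cbmeas_fst _ (cbmeas_expval_ket _ _)).
exact: (cbmeas_snd _ (cbmeas_expval_ket _ _)).
Qed.

(** Independence factors each term of the double sum, and the one-register recursion applies to both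
    factors; [swap_sum] is what the products add up to. *)
Lemma cexp_ov_reg_tens N M (Y : 'M[C]_(pw d N)) (Z : 'M[C]_(pw d M)) :
  cexp hh (fun w => ov w * expval (Y *t Z) (reg N M w)) =
  ((d + N)%:R * (d + M)%:R)^-1 *
  cexp hh (fun w => expval ((Y *t Z) *m swap_sum R d N M) (reg N M w)).
Proof.
have bN a b : cbmeas (fun u : G => expval (delta_mx a b) (ket u) *
    expval Y (tv (ket u) N)).
  by apply: cbmeasM; [exact: cbmeas_expval_ket | exact: cbmeas_expval_tv].
have bM a b : cbmeas (fun u : G => expval (delta_mx a b) (ket u) *
    expval Z (tv (ket u) M)).
  by apply: cbmeasM; [exact: cbmeas_expval_ket | exact: cbmeas_expval_tv].
pose F a b (w : G * G) := expval (delta_mx a b) (ket w.1) *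
    expval Y (tv (ket w.1) N) *
    (expval (delta_mx b a) (ket w.2) * expval Z (tv (ket w.2) M)).
pose H a b (w : G * G) :=
  expval (Y *m ((a == b)%:R%:M + deriv (delta_mx a b) N)) (tv (ket w.1) N) *
  expval (Z *m ((b == a)%:R%:M + deriv (delta_mx b a) M)) (tv (ket w.2) M).
have bF a b : cbmeas (F a b).
  by apply: cbmeasM; [exact: (cbmeas_fst _ (bN _ _)) |
    exact: (cbmeas_snd _ (bM _ _))].
have bH a b : cbmeas (H a b).
  by apply: cbmeasM; [exact: (cbmeas_fst _ (cbmeas_expval_tv _ _)) |
    exact: (cbmeas_snd _ (cbmeas_expval_tv _ _))].
transitivity (cexp hh (fun w => \sum_a \sum_b F a b w)).
  congr cexp; apply/funext => w; rewrite /overlapC mulr_suml.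
  apply: eq_bigr => a _; rewrite mulr_suml; apply: eq_bigr => b _.
  by rewrite expval_tens mulrACA.
transitivity (((d + N)%:R * (d + M)%:R)^-1 *
    cexp hh (fun w => \sum_a \sum_b H a b w)); last first.
  congr (_ * cexp _ _); apply/funext => w; rewrite /swap_sum mulmx_sumr.
  rewrite expval_sum; apply: eq_bigr => a _; rewrite mulmx_sumr expval_sum.
  by apply: eq_bigr => b _; rewrite tensmx_mul expval_tens.
rewrite !cexp_sum; do ?by move=> a; apply: cbmeas_sum.
rewrite mulr_sumr; apply: eq_bigr => a _.
rewrite !cexp_sum // mulr_sumr; apply: eq_bigr => b _.
rewrite (cexp_tens haar haar (bN a b) (bM b a)) !moment_rec //.
rewrite (cexp_tens haar haar
  (cbmeas_expval_tv ket0 (Y *m ((a == b)%:R%:M + deriv (delta_mx a b) N)))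
  (cbmeas_expval_tv ket0 (Z *m ((b == a)%:R%:M + deriv (delta_mx b a) M)))).
by rewrite invfM /moment; ring.
Qed.

(** Both sides are linear in X, and every matrix unit of the joint space is a tensor product of
    matrix units. *)
Lemma cexp_ov_reg N M (X : 'M[C]_(pw d N * pw d M)) :
  cexp hh (fun w => ov w * expval X (reg N M w)) =
  ((d + N)%:R * (d + M)%:R)^-1 *
  cexp hh (fun w => expval (X *m swap_sum R d N M) (reg N M w)).
Proof.
have bx Y : cbmeas (fun w : G * G => expval Y (reg N M w)).
  by apply: cbmeas_expval => i; exact: cbmeas_reg.
have bo Y : cbmeas (fun w : G * G => ov w * expval Y (reg N M w)).
  by apply: cbmeasM; [exact: cbmeas_ov|].
have bZ s Y : cbmeas (fun w : G * G => s * expval Y (reg N M w)).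
  by apply: cbmeasM; [exact: cbmeas_cst|].
have bZo s Y : cbmeas (fun w : G * G => s * (ov w * expval Y (reg N M w))).
  by apply: cbmeasM; [exact: cbmeas_cst|].
pose S := swap_sum R d N M.
transitivity (cexp hh (fun w => \sum_i \sum_j
    X i j * (ov w * expval (delta_mx i j) (reg N M w)))).
  congr cexp; apply/funext => w; rewrite [in LHS](matrix_sum_delta X).
  rewrite expval_sum mulr_sumr; apply: eq_bigr => i _.
  rewrite expval_sum mulr_sumr; apply: eq_bigr => j _.
  by rewrite expvalZ mulrCA.
transitivity (((d + N)%:R * (d + M)%:R)^-1 * cexp hh (fun w => \sum_i \sum_j
    X i j * expval (delta_mx i j *m S) (reg N M w))); last first.
  congr (_ * cexp _ _); apply/funext => w.
  rewrite [in RHS](matrix_sum_delta X) mulmx_suml expval_sum.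
  apply: eq_bigr => i _; rewrite mulmx_suml expval_sum.
  by apply: eq_bigr => j _; rewrite -scalemxAl expvalZ.
rewrite !cexp_sum; do ?by move=> i; apply: cbmeas_sum.
rewrite mulr_sumr; apply: eq_bigr => i _.
rewrite !cexp_sum // mulr_sumr; apply: eq_bigr => j _.
rewrite (cexpZ hh (X i j) (bo (delta_mx i j))).
rewrite [Y in _ = _ * Y](cexpZ hh (X i j) (bx (delta_mx i j *m S))).
rewrite [RHS]mulrCA; congr (_ * _).
case: (mxtens_indexP i) => i1 i2; case: (mxtens_indexP j) => j1 j2.
by rewrite delta_mx_tens cexp_ov_reg_tens.
Qed.

(** The preceding identity for two empty registers, where the swap sum has expectation d. *)
Lemma cexp_ov : cexp hh (fun w => ov w) = d%:R^-1.
Proof.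
have d0 : d%:R != 0 :> C by rewrite pnatr_eq0 -lt0n.
transitivity (cexp hh (fun w => ov w * expval 1%:M (reg 0 0 w))).
  by congr cexp; apply/funext => w; rewrite expval1 ?mulr1//;
    apply: tensv_unit; apply: tv_unit; exact: ket_unit.
rewrite cexp_ov_reg mul1mx !addn0.
transitivity ((d%:R * d%:R)^-1 * cexp hh (fun=> d%:R)); last first.
  by rewrite cexp_cst invfM mulfVK.
congr (_ * cexp _ _); apply/funext => w.
rewrite expval_swap_sum; [|exact: ket_unit|exact: ket_unit].
by rewrite !addn0 mul0r addr0.
Qed.

Lemma cexp_delta (a b : 'I_d) :
  cexp haar (fun u => expval (delta_mx a b) (ket u)) = d%:R^-1 * (a == b)%:R.
Proof.
transitivity (cexp haar (fun u => expval (delta_mx a b) (ket u) *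
    expval 1%:M (tv (ket u) 0))).
  congr cexp; apply/funext => u; rewrite expval1 ?mulr1 //.
  by apply: tv_unit; exact: ket_unit.
rewrite moment_rec // addn0 mul1mx /= addr0 -scalemx1 momentZ moment1 //.
by rewrite mulr1.
Qed.

(** The recursion with n = 1; equivalently, two copies average to (1 + SWAP) / (d (d + 1)). *)
Lemma cexp_delta2 (a b e f : 'I_d) :
  cexp haar (fun u => expval (delta_mx a b) (ket u) *
                      expval (delta_mx e f) (ket u)) =
  (d%:R * (d%:R + 1))^-1 *
  ((a == b)%:R * (e == f)%:R + (f == a)%:R * (e == b)%:R).
Proof.
have m1 X : moment (X *t 1%:M : 'M[C]_(pw d 1)) =
    cexp haar (fun u => expval X (ket u)).
  congr cexp; apply/funext => u; rewrite expval_tens expval1 ?mulr1 //.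
  by rewrite trmxC1 mulmx1.
have rec := moment_rec d_gt0 haarP ket0_unit (n := 1)
  (delta_mx e f *t 1%:M) a b.
apply: (etrans _ (etrans rec _)).
  congr cexp; apply/funext => u; rewrite expval_tens [expval 1%:M _]expval1.
    by congr (_ * _); rewrite [RHS]mulr1.
  by rewrite trmxC1 mulmx1.
rewrite mulmxDr momentD mul_mx_scalar momentZ /= tensmx0 addr0.
rewrite tensmx_mul mulmx1 mul_delta_mx_cond !m1 cexp_delta natrD invfM.
rewrite (_ : cexp _ _ = (f == a)%:R * (d%:R^-1 * (e == b)%:R)); first by ring.
rewrite -cexp_delta; case: (f == a); first by rewrite mulr1n mul1r.
rewrite mulr0n mul0r -[RHS](cexp_cst haar); congr cexp.
by apply/funext => u; rewrite expval0.
Qed.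

Lemma sum_pred1_mul (I : finType) (i : I) (F : I -> C) :
  \sum_j (i == j)%:R * F j = F i.
Proof.
rewrite (bigD1 i) //= eqxx mul1r big1 ?addr0 // => j ji.
by rewrite eq_sym (negbTE ji) mul0r.
Qed.

(** By independence each term is a product of two equal second moments. The square of the sum of
    deltas adds up to d^2 + d^2 + 2 d, against the prefactor (d (d + 1))^-2. *)
Lemma cexp_ov2 : cexp hh (fun w => ov w ^+ 2) = 2 / (d%:R * (d%:R + 1)).
Proof.
have d0 : d%:R != 0 :> C by rewrite pnatr_eq0 -lt0n.
have d10 : d%:R + 1 != 0 :> C by rewrite natr1 pnatr_eq0.
have b2 a b e f : cbmeas (fun u : G => expval (delta_mx a b) (ket u) *
                      expval (delta_mx e f) (ket u)).
  by apply: cbmeasM; exact: cbmeas_expval_ket.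
pose F a b e f (w : G * G) :=
  expval (delta_mx a b) (ket w.1) * expval (delta_mx e f) (ket w.1) *
  (expval (delta_mx b a) (ket w.2) * expval (delta_mx f e) (ket w.2)).
have bF a b e f : cbmeas (F a b e f).
  by apply: cbmeasM; [exact: (cbmeas_fst _ (b2 _ _ _ _)) |
    exact: (cbmeas_snd _ (b2 _ _ _ _))].
transitivity (cexp hh (fun w => \sum_a \sum_b \sum_e \sum_f F a b e f w)).
  congr cexp; apply/funext => w; rewrite expr2 {1}/overlapC mulr_suml.
  apply: eq_bigr => a _; rewrite mulr_suml; apply: eq_bigr => b _.
  rewrite /overlapC mulr_sumr; apply: eq_bigr => e _.
  by rewrite mulr_sumr; apply: eq_bigr => f _; rewrite mulrACA.
(* Deltas are idempotent. They are ordered so that [sum_pred1_mul] eliminates f, then e, then b. *)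
transitivity (\sum_(a < d) \sum_(b < d) \sum_(e < d) \sum_(f < d)
    (d%:R * (d%:R + 1))^-1 ^+ 2 *
    ((e == f)%:R * (a == b)%:R + (a == f)%:R * (b == e)%:R +
     (e == f)%:R * (2 * ((b == e)%:R * ((a == b)%:R * (f == a)%:R))) : C)).
  rewrite cexp_sum; last by move=> a; do 3 (apply: cbmeas_sum => ?).
  apply: eq_bigr => a _.
  rewrite cexp_sum; last by move=> b; do 2 (apply: cbmeas_sum => ?).
  apply: eq_bigr => b _.
  rewrite cexp_sum; last by move=> e; apply: cbmeas_sum => ?.
  apply: eq_bigr => e _; rewrite cexp_sum //.
  apply: eq_bigr => f _.
  apply: (etrans (cexp_tens haar haar (b2 a b e f) (b2 b a f e))).
  rewrite (cexp_delta2 a b e f) (cexp_delta2 b a f e).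
  rewrite [b == a]eq_sym [f == e]eq_sym [f == a]eq_sym [e == b]eq_sym.
  case: (a == b) => /=; case: (e == f) => /=;
    case: (a == f) => /=; case: (b == e) => /=;
    rewrite ?mulr1n ?mulr0n; ring.
transitivity (\sum_(a < d) \sum_(b < d) (d%:R * (d%:R + 1))^-1 ^+ 2 *
    (d%:R * (a == b)%:R + 1 + 2 * (a == b)%:R) : C).
  apply: eq_bigr => a _; apply: eq_bigr => b _.
  transitivity (\sum_(e < d) (d%:R * (d%:R + 1))^-1 ^+ 2 *
    ((a == b)%:R + (b == e)%:R * 1 +
     (b == e)%:R * (2 * ((a == b)%:R * (e == a)%:R))) : C).
    apply: eq_bigr => e _; rewrite -mulr_sumr !big_split /= !sum_pred1_mul.
    by rewrite mulr1 [2 * _]mulrCA.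
  rewrite -mulr_sumr !big_split /= !sum_pred1_mul sumr_const card_ord.
  rewrite [b == a]eq_sym; congr (_ * (_ + _ * _)).
    by rewrite mulr_natl.
  by case: (a == b); rewrite ?mulr1n ?mulr0n ?mulr1 ?mulr0.
transitivity (\sum_(a < d) (d%:R * (d%:R + 1))^-1 ^+ 2 *
    (d%:R + d%:R + 2) : C).
  apply: eq_bigr => a _; rewrite -mulr_sumr !big_split /= sumr_const card_ord.
  congr (_ * _).
  have one (x : C) : \sum_(b < d) x * (a == b)%:R = x.
    by under eq_bigr do rewrite mulrC; rewrite sum_pred1_mul.
  by rewrite !one.
rewrite sumr_const card_ord -[LHS]mulr_natl.
by field; rewrite d0 d10.
Qed.

End two_registers.

(** * Optimal measurement *)

Section spectral_povm.
Variables (R : realType) (D : nat) (L : 'M[R[i]]_D).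
Hypothesis L_herm : L^t* = L.
Local Notation C := R[i].
Local Notation P := (spectralmx L).

(** One rank-one projection per vector of an eigenbasis, so an eigenvalue of multiplicity r is
    shared by r outcomes. *)
Definition spectral_effect (k : 'I_D) : 'M[C]_D := P^t* *m delta_mx k k *m P.

Definition spectral_value (k : 'I_D) : R := complex.Re (spectral_diag L 0 k).

Let PP : P *m P^t* = 1%:M.
Proof. exact/unitarymxP/spectral_unitarymx. Qed.

Let hermL : L \is hermsymmx.
Proof. by apply/is_hermitianmxP; rewrite expr0 scale1r L_herm. Qed.

Lemma mul_spectral_effect k :
  L *m spectral_effect k = (spectral_value k)%:C *: spectral_effect k.
Proof.
have /orthomx_spectralP LE := hermitian_normalmx hermL.
have real_k : spectral_diag L 0 k = (spectral_value k)%:C.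
  rewrite /spectral_value RRe_real //.
  by have /mxOverP := hermitian_spectral_diag_real hermL; exact.
rewrite {1}LE invmx_unitary ?spectral_unitarymx // /spectral_effect.
rewrite -!mulmxA (mulmxA P) PP mul1mx (mulmxA (diag_mx _)).
rewrite mul_diag_mx.
rewrite (_ : \matrix_(i, j) _ = (spectral_value k)%:C *: delta_mx k k).
  by rewrite -scalemxAl -scalemxAr.
apply/matrixP => i j; rewrite !mxE -real_k.
by case: eqP => [->|]; rewrite ?mulr0.
Qed.

Lemma spectral_povm : projective_povm spectral_effect.
Proof.
have herm k : (spectral_effect k)^t* = spectral_effect k.
  by rewrite /spectral_effect !trmxC_mul trmxCK trmxC_delta mulmxA.
split; last first.
  move=> k l; rewrite /spectral_effect -!mulmxA (mulmxA P) PP mul1mx.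
  rewrite (mulmxA (delta_mx k k)) mul_delta_mx_cond.
  by case: eqP => [->|]; rewrite ?mulr1n // mulr0n mul0mx mulmx0.
split=> [k|].
  split; first by apply/is_hermitianmxP; rewrite expr0 scale1r herm.
  move=> x; rewrite /spectral_effect -expval_mulmx expval_delta.
  by rewrite mulrC mul_conjC_ge0.
rewrite /spectral_effect -mulmx_suml -mulmx_sumr.
by rewrite -mx1_sum_delta mulmx1 (mulmx1C PP).
Qed.

End spectral_povm.

Lemma conjC_real_complex (R : realType) (r : R) : (r%:C)^*%R = r%:C :> R[i].
Proof. exact: conjc_real. Qed.

(** * Decomposition of the mean square error around the posterior-mean operator *)

Section bayes_risk.
Context (dp : measure_display) (T : measurableType dp) (R : realType).
Variable P : probability T R.
Local Notation C := R[i].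
Variables (D : nat) (x : T -> 'cV[C]_D) (o : T -> C) (L : 'M[C]_D).
Hypothesis bx : forall i, cbmeas (fun t => x t i 0).
Hypothesis x_unit : forall t, (x t)^t* *m x t = 1%:M.
Hypothesis bo : cbmeas o.
Hypothesis o_real : forall t, (o t)^*%R = o t.
Hypothesis L_herm : L^t* = L.
(* L plays the role of a conditional expectation of o. *)
Hypothesis posterior : forall X : 'M[C]_D,
  cexp P (fun t => o t * expval X (x t)) =
  cexp P (fun t => expval (X *m L) (x t)).

Let J X := cexp P (fun t => expval X (x t)).

Let bJ X : cbmeas (fun t => expval X (x t)).
Proof. exact: cbmeas_expval. Qed.

Lemma cexp_conj (f : T -> C) : cbmeas f ->
  cexp P (fun t => (f t)^*%R) = (cexp P f)^*%R.
Proof.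
move=> [rf jf]; apply/eqP; rewrite eq_complex /=; apply/andP; split; apply/eqP.
  by apply: eq_Rintegral => t _; case: (f t).
rewrite -mulN1r -RintegralZl //; last exact: bmeas_integrable.
by apply: eq_Rintegral => t _; rewrite mulN1r; case: (f t).
Qed.

Let JP s X Y : J (s *: X + Y) = s * J X + J Y.
Proof.
rewrite /J -cexpZ // -cexpD //; last by apply: cbmeasM => //; exact: cbmeas_cst.
by congr cexp; apply/funext => t; rewrite expvalD expvalZ.
Qed.

(** L E is the adjoint of E L, and J (E L) is real because it is the mean of the real variable o
    <E>. *)
Let J_herm (E : 'M[C]_D) : E^t* = E -> J (L *m E) = J (E *m L).
Proof.
move=> Eh.
have -> : L *m E = (E *m L)^t* by rewrite trmxC_mul Eh L_herm.
transitivity ((J (E *m L))^*%R).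
  rewrite /J -cexp_conj //; congr cexp; apply/funext => t.
  by rewrite expval_conj.
rewrite /J -posterior -cexp_conj; last exact: cbmeasM.
by congr cexp; apply/funext => t; rewrite rmorphM /= o_real -expval_conj Eh.
Qed.

(** Completing the square: [posterior] turns the cross term into -2 c J (E L), [J_herm] splits it
    evenly between E L and L E, and J (L E L) is added and subtracted. *)
Lemma bayes_risk_effect (c : R) (E : 'M[C]_D) : E^t* = E ->
  cexp P (fun t => (c%:C - o t) ^+ 2 * expval E (x t)) =
  cexp P (fun t => expval E ((c%:C%:M - L) *m x t)) +
  (cexp P (fun t => o t ^+ 2 * expval E (x t)) - J (L *m E *m L)).
Proof.
move=> Eh.
have bo2 : cbmeas (fun t => o t ^+ 2 * expval E (x t)).
  by apply: cbmeasM => //; under [X in cbmeas X]eq_fun do rewrite expr2;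
    exact: cbmeasM.
have bZ (s : C) (f : T -> C) : cbmeas f -> cbmeas (fun t => s * f t).
  by move=> bf; apply: cbmeasM => //; exact: cbmeas_cst.
have boE : cbmeas (fun t => o t * expval E (x t)) by exact: cbmeasM.
transitivity (c%:C ^+ 2 * J E + (- (2 * c%:C) * J (E *m L) +
    cexp P (fun t => o t ^+ 2 * expval E (x t)))).
  have -> : J (E *m L) = cexp P (fun t => o t * expval E (x t)).
    by rewrite posterior.
  have b1 := bZ (c%:C ^+ 2) _ (bJ E).
  have b2 := bZ (- (2 * c%:C)) _ boE.
  rewrite /J -(cexpZ P (c%:C ^+ 2) (bJ E)) -(cexpZ P (- (2 * c%:C)) boE).
  rewrite -(cexpD P b2 bo2) -(cexpD P b1 (cbmeasD b2 bo2)).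
  by congr cexp; apply/funext => t; ring.
transitivity (J (c%:C ^+ 2 *: E + (- c%:C *: (L *m E) +
    (- c%:C *: (E *m L) + L *m E *m L))) +
    (cexp P (fun t => o t ^+ 2 * expval E (x t)) - J (L *m E *m L))).
  rewrite (JP (c%:C ^+ 2) E) (JP (- c%:C) (L *m E)) (JP (- c%:C) (E *m L)).
  rewrite (J_herm Eh).
  move: (J E) (J (E *m L)) (J (L *m E *m L)) (cexp P _) => u v w z.
  by ring.
congr (_ + _); congr cexp; apply/funext => t.
rewrite expval_mulmx; congr (expval _ _).
have -> : (c%:C%:M - L)^t* = c%:C%:M - L.
  rewrite trmxCD -[- L]scaleN1r trmxCZ L_herm rmorphN /= conjC1 scaleN1r.
  by rewrite tr_scalar_mx map_scalar_mx /= conjC_real_complex.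
rewrite mulmxBr mulmxBl mul_scalar_mx !mul_mx_scalar mulmxBl -scalemxAl.
move: (L *m E *m L) (L *m E) (E *m L) => w u v.
by apply/matrixP => i j; rewrite !mxE; ring.
Qed.

(** Completeness of the POVM makes the remainders add up to E[o^2] - J (L L), and [posterior] at X =
    L rewrites J (L L); no trace of the measurement is left there. *)
Lemma bayes_risk_povm m (E : 'I_m -> 'M[C]_D) (c : 'I_m -> R) :
  (forall k, (E k)^t* = E k) -> \sum_k E k = 1%:M ->
  \sum_k cexp P (fun t => ((c k)%:C - o t) ^+ 2 * expval (E k) (x t)) =
  \sum_k cexp P (fun t => expval (E k) (((c k)%:C%:M - L) *m x t)) +
  (cexp P (fun t => o t ^+ 2) - cexp P (fun t => o t * expval L (x t))).
Proof.
move=> Eh E1.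
rewrite (eq_bigr _ (fun k _ => bayes_risk_effect (c k) (Eh k))).
rewrite big_split /= sumrB; congr (_ + (_ - _)).
  rewrite -cexp_sum; last first.
    move=> k; apply: cbmeasM => //.
    by under [X in cbmeas X]eq_fun do rewrite expr2; exact: cbmeasM.
  congr cexp; apply/funext => t; rewrite -mulr_sumr -expval_sum E1 expval1 //.
  by rewrite mulr1.
rewrite posterior /J -cexp_sum //; congr cexp; apply/funext => t.
rewrite -expval_sum; congr (expval _ _).
by rewrite -mulmx_suml -mulmx_sumr E1 mulmx1.
Qed.

Lemma Re_cexp_ge0 (f : T -> C) : (forall t, 0 <= f t) ->
  0 <= complex.Re (cexp P f).
Proof.
move=> f0; apply: Rintegral_ge0 => t _.
by have := f0 t; rewrite lecE => /andP[].
Qed.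

End bayes_risk.

(** * Application to the joint state and evaluation of the optimum *)

Section optimal_estimation.
Variables (R : realType) (d N M : nat) (haar : probability (SU R d) R).
Variable ket0 : 'cV[R[i]]_d.
Hypothesis d_gt0 : (0 < d)%N.
Hypothesis haarP : haar_probability haar.
Hypothesis ket0_unit : ket0^t* *m ket0 = 1%:M.
Local Notation C := R[i].
Local Notation G := (SU R d).
Local Notation D := (d ^ (N + M))%N.
Local Notation ket u := (su_mx u *m ket0).
Local Notation hh := (haar \x haar)%E.
Local Notation ov w := (overlapC (ket w.1) (ket w.2)).
Local Notation js w := (joint_state N M (ket w.1) (ket w.2)).
Local Notation kappa := (((d + N)%:R * (d + M)%:R)^-1 : C).

Let dim_reg : (pw d N * pw d M = D)%N.
Proof.
have pwE n : pw d n = (d ^ n)%N by elim: n => //= n ->; rewrite expnS.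
by rewrite !pwE expnD.
Qed.

Lemma joint_state_unit w : (js w)^t* *m js w = 1%:M.
Proof.
rewrite (joint_state_tv _ _ dim_reg); case: _ / dim_reg; rewrite castmx_id.
by apply: tensv_unit; apply: tv_unit; exact: ket_unit.
Qed.

Lemma cbmeas_joint_state i : cbmeas (fun w : G * G => js w i 0).
Proof.
under [X in cbmeas X]eq_fun do rewrite (joint_state_tv _ _ dim_reg).
move: i; case: _ / dim_reg => i.
by under [X in cbmeas X]eq_fun do rewrite castmx_id; exact: cbmeas_reg.
Qed.

Lemma posterior_mean_operator : exists L : 'M[C]_D,
  [/\ L^t* = L,
   forall X, cexp hh (fun w => ov w * expval X (js w)) =
             cexp hh (fun w => expval (X *m L) (js w)) &
   forall w, expval L (js w) =
             kappa * ((d + N + M)%:R + (N * M)%:R * ov w)].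
Proof.
(* With the state written as an explicit cast, the equality [dim_reg] can be eliminated and L built
   on the product space. *)
suff: exists L : 'M[C]_D,
  let st w := castmx (dim_reg, erefl 1%N)
    (tensv (tv (ket w.1) N) (tv (ket w.2) M)) in
  [/\ L^t* = L,
   forall X, cexp hh (fun w => ov w * expval X (st w)) =
             cexp hh (fun w => expval (X *m L) (st w)) &
   forall w : G * G, expval L (st w) =
             kappa * ((d + N + M)%:R + (N * M)%:R * ov w)].
  move=> [L [Lh LX Lo]]; exists L; split=> // [X|w].
    transitivity (cexp hh (fun w => ov w * expval X
      (castmx (dim_reg, erefl 1%N) (tensv (tv (ket w.1) N) (tv (ket w.2) M))))).
      by congr cexp; apply/funext => w; rewrite (joint_state_tv _ _ dim_reg).
    rewrite LX.
    by congr cexp; apply/funext => w; rewrite (joint_state_tv _ _ dim_reg).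
  by rewrite (joint_state_tv _ _ dim_reg) Lo.
case: _ / dim_reg.
exists (kappa *: swap_sum R d N M); split=> [|X|w].
- rewrite trmxCZ trmxC_swap_sum; congr (_ *: _).
  by rewrite -natrM fmorphV rmorph_nat.
- transitivity (cexp hh (fun w => ov w *
    expval X (tensv (tv (ket w.1) N) (tv (ket w.2) M)))).
    by congr cexp; apply/funext => w; rewrite castmx_id.
  rewrite (cexp_ov_reg d_gt0 haarP ket0_unit) -cexpZ; last first.
    by apply: cbmeas_expval => i; exact: cbmeas_reg.
  congr cexp; apply/funext => w.
  by rewrite castmx_id -scalemxAr expvalZ.
- rewrite castmx_id expvalZ expval_swap_sum //; exact: ket_unit.
Qed.

Lemma overlapC_real (psi phi : 'cV[C]_d) :
  overlapC psi phi = (overlap psi phi)%:C.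
Proof.
rewrite /overlap sqr_norm_overlapC RRe_real // -sqr_norm_overlapC.
by rewrite rpredX // normr_real.
Qed.

Lemma global_mseE m (E : 'I_m -> 'M[C]_D) (c : 'I_m -> R) :
  global_mse haar ket0 E c = (complex.Re (\sum_k cexp hh (fun w =>
    ((c k)%:C - ov w) ^+ 2 * expval (E k) (js w))))%:E.
Proof.
rewrite raddf_sum -sumEFin; apply: eq_bigr => k _.
have [bf _] : cbmeas (fun w : G * G =>
    ((c k)%:C - ov w) ^+ 2 * expval (E k) (js w)).
  apply: cbmeasM; last first.
    by apply: cbmeas_expval => i; exact: cbmeas_joint_state.
  have b1 : cbmeas (fun w : G * G => (c k)%:C - ov w).
    apply: cbmeasD; first exact: cbmeas_cst.
    under [X in cbmeas X]eq_fun do rewrite -mulN1r.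
    apply: cbmeasM; [exact: cbmeas_cst | exact: cbmeas_ov].
  by under [X in cbmeas X]eq_fun do rewrite expr2; exact: cbmeasM.
rewrite /= /Rintegral fineK; last first.
  by apply: integrable_fin_num => //; exact: (bmeas_integrable hh bf).
apply: eq_integral => w _; congr EFin.
(* The squared error is real, so taking the real part commutes with multiplying by it. *)
rewrite overlapC_real /outcome_prob -rmorphB -rmorphXn ReM /=.
by rewrite mul0r subr0.
Qed.

(** <L> is affine in the overlap, so only its first two moments, 1/d and 2/(d (d + 1)), enter. *)
Lemma optimal_mse :
  cexp hh (fun w => ov w ^+ 2) - cexp hh (fun w => ov w *
    (kappa * ((d + N + M)%:R + (N * M)%:R * ov w))) =
  ((d%:R - 1) * (d%:R + M%:R + N%:R) /
   (d%:R * (d%:R + 1) * (d%:R + M%:R) * (d%:R + N%:R)))%:C.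
Proof.
have bo : cbmeas (fun w : G * G => ov w) by exact: cbmeas_ov.
have bo2 : cbmeas (fun w : G * G => ov w ^+ 2).
  by under [X in cbmeas X]eq_fun do rewrite expr2; exact: cbmeasM.
transitivity (cexp hh (fun w => ov w ^+ 2) -
  (kappa * (d + N + M)%:R * cexp hh (fun w => ov w) +
   kappa * (N * M)%:R * cexp hh (fun w => ov w ^+ 2))).
  congr (_ - _); rewrite -(cexpZ hh (kappa * (d + N + M)%:R) bo).
  rewrite -(cexpZ hh (kappa * (N * M)%:R) bo2) -cexpD.
  - by congr cexp; apply/funext => w; move: (overlapC _ _) => o; ring.
  - by apply: cbmeasM => //; exact: cbmeas_cst.
  - by apply: cbmeasM => //; exact: cbmeas_cst.
rewrite (cexp_ov d_gt0 haarP ket0_unit) (cexp_ov2 d_gt0 haarP ket0_unit).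
have nz k : d%:R + k%:R != 0 :> C.
  by rewrite -natrD pnatr_eq0 addn_eq0 negb_and -lt0n d_gt0.
have d0 : d%:R != 0 :> C by rewrite pnatr_eq0 -lt0n.
rewrite !(rmorphM, rmorphB, rmorphD, fmorphV, rmorph_nat, rmorph1) /=.
rewrite ?natrD ?natrM; field.
by rewrite d0 !nz (nz 1%N).
Qed.

End optimal_estimation.

Theorem mainTheorem2 (R : realType) (d N M : nat)
    (haar : probability (SU R d) R) (ket0 : 'cV[R[i]]_d)
    (d_ge2 : (2 <= d)%N) (N_ge1 : (1 <= N)%N) (M_ge1 : (1 <= M)%N)
    (haarP : haar_probability haar)
    (ket0_unit : ket0^t* *m ket0 = 1%:M) :
  let v_op : R := (d%:R - 1) * (d%:R + M%:R + N%:R) /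
                  (d%:R * (d%:R + 1) * (d%:R + M%:R) * (d%:R + N%:R)) in
  (exists (m : nat) (E : 'I_m -> 'M[R[i]]_(d ^ (N + M))) (c : 'I_m -> R),
      projective_povm E /\ global_mse haar ket0 E c = v_op%:E) /\
  (forall (m : nat) (E : 'I_m -> 'M[R[i]]_(d ^ (N + M))) (c : 'I_m -> R),
      povm E -> (v_op%:E <= global_mse haar ket0 E c)%E).
Proof.
move=> v_op; have d_gt0 : (0 < d)%N := ltnW d_ge2.
have [L [L_herm LX Lo]] := posterior_mean_operator N M d_gt0 haarP ket0_unit.
have psd_herm m (E : 'I_m -> 'M[R[i]]_(d ^ (N + M))) : povm E ->
    forall k, (E k)^t* = E k.
  by move=> [Epsd _] k; have [/is_hermitianmxP] := Epsd k; rewrite expr0 scale1r.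
(* Every risk is [v_op] plus a sum that depends on the measurement and is nonnegative by positivity
   of the effects. *)
have mseE m (E : 'I_m -> 'M[R[i]]_(d ^ (N + M))) (c : 'I_m -> R) : povm E ->
    global_mse haar ket0 E c = (complex.Re (\sum_k cexp (haar \x haar)%E (fun w =>
      expval (E k) (((c k)%:C%:M - L) *m
        joint_state N M (su_mx w.1 *m ket0) (su_mx w.2 *m ket0)))) + v_op)%:E.
  move=> Epovm; rewrite global_mseE; congr EFin.
  have ReD (z : R[i]) : complex.Re z + v_op = complex.Re (z + v_op%:C).
    by case: z.
  rewrite ReD; congr complex.Re.
  rewrite (bayes_risk_povm (cbmeas_joint_state ket0)
    (joint_state_unit N M ket0_unit) (cbmeas_ov ket0) _ L_herm LX c
    (psd_herm _ _ Epovm) Epovm.2); last first.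
    by move=> w; rewrite overlapC_real conjC_real_complex.
  rewrite -(optimal_mse N M d_gt0 haarP ket0_unit).
  by congr (_ + (_ - cexp _ _)); apply/funext => w; rewrite Lo.
split; last first.
  move=> m E c Epovm; rewrite mseE // lee_fin lerDr raddf_sum sumr_ge0 // => k _.
  by apply: Re_cexp_ge0 => w; have [] := Epovm.1 k.
(* Measuring in an eigenbasis of L and reporting the eigenvalue makes every term of that sum
   vanish. *)
exists (d ^ (N + M))%N, (spectral_effect L), (spectral_value L).
have proj := spectral_povm L; split => //.
rewrite mseE; last by case: proj.
rewrite big1 ?add0r // => k _; rewrite -[RHS](cexp_cst (haar \x haar)%E).
congr cexp; apply/funext => w.
have Eh := psd_herm _ _ proj.1 k.
have LE : ((spectral_value L k)%:C%:M - L) *m spectral_effect L k = 0.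
  by rewrite mulmxBl mul_spectral_effect // mul_scalar_mx subrr.
have EL : spectral_effect L k *m ((spectral_value L k)%:C%:M - L) = 0.
  (* The adjoint of [LE]: both operators are hermitian and the eigenvalue is real. *)
  have /(congr1 (fun A => A^t*)) := LE.
  rewrite trmxC_mul Eh trmx0 map_mx0 trmxCD -scaleN1r trmxCZ L_herm.
  rewrite rmorphN /= conjC1 tr_scalar_mx map_scalar_mx /=.
  by rewrite conjC_real_complex scaleN1r => ->.
by rewrite expval_mulmx -mulmxA EL mulmx0 expval0.
Qed.
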